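(* Let $p$ be a prime, $\mathbf{k}$ an algebraically closed field of characteristic $p$, and $V=\mathbf{k}^3$ (so $n=3$). Let $d,e\geq 0$ be integers such that $h^1(d,e)\neq 0$. 1. If $d>e$, then the (lexicographically) highest weight in $h^1(d,e)$ is $$(d-1-e)\omega_1+e\omega_2=(d-1,e,0).$$ 2. If $d\leq e$, then there exist $q'=p^s$ and an integer $m>0$ satisfying $$d=mq'+d',\quad e=mq'+e',\quad p\nmid m,\quad 0\leq d',e'\leq q'-2.$$ If $q'$ is the smallest power of $p$ for which there exist integers $m>0$, $d'$, $e'$ with $d=mq'+d'$, $e=mq'+e'$, $p\nmid m$ and $0\leq d',e'\leq q'-2$, and $m,d',e'$ are the corresponding integers, then the highest weight in $h^1(d,e)$ is $$d'\omega_1+(e-2e'-2)\omega_2=(d-e'-2,\,e-2e'-2,\,0).$$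
   Context: $\mathbf{P}=\mathbb{P}V=\operatorname{Proj}(\operatorname{Sym}V)\simeq\mathbf{P}^2$, with tautological sequence $0\to\mathcal{R}\to V\otimes\mathcal{O}_{\mathbf{P}}\to\mathcal{O}_{\mathbf{P}}(1)\to 0$. $D^d$ is the $d$-th divided power functor, $D^d\mathcal{R}=(\operatorname{Sym}^d(\mathcal{R}^{\vee}))^{\vee}$, and $\mathcal{F}(e)=\mathcal{F}\otimes\mathcal{O}_{\mathbf{P}}(e)$. $h^1(d,e)=[H^1(\mathbf{P},D^d\mathcal{R}(e-1))]$ is the character of this $\operatorname{SL}_3$-representation, an element of $A=\mathbb{Z}[x_1,x_2,x_3]/\langle x_1x_2x_3-1\rangle$ (with $[V]=x_1+x_2+x_3$). Weights of $\operatorname{SL}_3$ are elements of $\mathbb{Z}^3/\mathbb{Z}(1,1,1)$; each is written uniquely as $(a,b,0)=(a-b)\omega_1+b\omega_2$, where $\omega_1=(1,0,0)$, $\omega_2=(1,1,0)$. The lexicographic order is: $(a_1,b_1,0)>(a_2,b_2,0)$ if $a_1>a_2$, or $a_1=a_2$ and $b_1>b_2$. A weight $(a,b,0)$ occurs in $f\in A$ if $x_1^ax_2^b$ has nonzero coefficient in $f$ under $A\simeq\mathbb{Z}[x_1^{\pm1},x_2^{\pm1}]$; the highest weight in $f\neq 0$ is the lexicographically largest weight occurring in $f$. *)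

(* Defs.v *)
From mathcomp Require Import all_boot all_order all_fingroup all_algebra.
From mathcomp Require Import generic_quotient fraction freeg mpoly.
From Stdlib Require Import ClassicalEpsilon.

Set Implicit Arguments.
Unset Strict Implicit.
Unset Printing Implicit Defensive.

Import GRing.Theory.
Local Open Scope ring_scope.

(* Sheaf cohomology on P = Proj (Sym V), V = k^3, is computed as Cech
   cohomology of the affine cover by D+(x_0), D+(x_1), D+(x_2), where x_0, x_1,
   x_2 are the standard basis vectors of V and U_I is the intersection of the
   D+(x_i) for i in a nonempty I : {set 'I_3}.
   All the sheaves involved are vector bundles, so restriction to smaller opens
   is injective and sections are represented inside the fibre over the generic
   point.  To treat all twists uniformly we work over K = Frac (Sym V), whose
   homogeneous elements of degree 0 form the function field of P; the degree
   is recorded in the definition of the sections of O(e). *)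
Notation conefun k := {fraction {mpoly k[3]}}.

Definition xK (k : fieldType) (i : 'I_3) : conefun k :=
  tofrac ('X_i : {mpoly k[3]}).

Definition scalK (k : fieldType) (c : k) : conefun k :=
  tofrac (c%:MP : {mpoly k[3]}).

(* f is a section of O(e) over U_I: an element of degree e of the localization
   of Sym V at the product of the x_i, i in I. *)
Definition OO (k : fieldType) (e : int) (I : {set 'I_3}) (f : conefun k)
    : Prop :=
  exists (g : {mpoly k[3]}) (deg N : nat),
    [/\ g \is deg.-homog, deg%:Z = e + (N * #|I|)%:Z
      & f = tofrac g / (\prod_(i in I) xK k i) ^+ N].

(* The generic fibre of R, the kernel of V (x) O -> O(1). *)
Definition RK (k : fieldType) : {vspace 'rV[conefun k]_3} :=
  lker (linfun (mulmxr (\col_(i < 3) xK k i))).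

Notation RKtype k := (subvs_of (RK k)).

Definition secR (k : fieldType) (I : {set 'I_3}) (v : RKtype k) : Prop :=
  forall i : 'I_3, OO 0 I (vsval v 0 i).

(* The generic fibre of the dual of R.  A homomorphism R -> O over U_I is the
   same thing as a linear form on the generic fibre mapping the sections of R
   over U_I to regular functions on U_I. *)
Notation RKdual k := 'Hom(RKtype k, (conefun k)^o).

Definition secRdual (k : fieldType) (I : {set 'I_3}) (l : RKdual k) : Prop :=
  forall v : RKtype k, secR I v -> OO 0 I (l v : conefun k).

(* D^d R = (Sym^d (R^dual))^dual, so a section of D^d R (x) O(e) is a linear
   map from Sym^d (R^dual) to O(e), that is, a symmetric d-linear map on R^dual
   with values in O(e). *)
Notation formK k d := ({ffun 'I_d -> RKdual k} -> conefun k).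

Definition upd (d : nat) (T : Type) (l : {ffun 'I_d -> T}) (i : 'I_d) (u : T)
    : {ffun 'I_d -> T} :=
  [ffun j => if j == i then u else l j].

Definition sym_multilinear (k : fieldType) (d : nat) (phi : formK k d) : Prop :=
  (forall (l : {ffun 'I_d -> RKdual k}) (i : 'I_d) (a : conefun k) (u v : RKdual k),
      phi (upd l i (a *: u + v)) = a * phi (upd l i u) + phi (upd l i v)) /\
  (forall (l : {ffun 'I_d -> RKdual k}) (s : 'S_d), phi [ffun i => l (s i)] = phi l).

Definition secDR (k : fieldType) (d : nat) (e : int) (I : {set 'I_3})
    (phi : formK k d) : Prop :=
  sym_multilinear phi /\
  forall l : {ffun 'I_d -> RKdual k},
    (forall i, secRdual I (l i)) -> OO e I (phi l).

(* The Cech complex of D^d R (e), with 1-cochains indexed by all pairs. *)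
Notation cochain1 k d := ('I_3 -> 'I_3 -> formK k d).

Definition cocycle1 (k : fieldType) (d : nat) (e : int) (s : cochain1 k d)
    : Prop :=
  (forall i j, secDR e [set i; j] (s i j)) /\
  (forall i j m l, s j m l - s i m l + s i j l = 0).

Definition coboundary1 (k : fieldType) (d : nat) (e : int) (s : cochain1 k d)
    : Prop :=
  exists c : 'I_3 -> formK k d,
    (forall i, secDR e [set i] (c i)) /\
    (forall i j l, s i j l = c j l - c i l).

(* The diagonal maximal torus of SL_3.  It preserves every U_I, hence acts on
   the Cech complex; t maps the basis vector x_i of V to t_i x_i. *)
Definition torus (k : fieldType) (t : 'I_3 -> k) : Prop :=
  \prod_(i < 3) t i = 1.

Definition torusV (k : fieldType) (t : 'I_3 -> k) : 'I_3 -> k :=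
  fun i => (t i)^-1.

Definition act_poly (k : fieldType) (t : 'I_3 -> k) (g : {mpoly k[3]})
    : {mpoly k[3]} :=
  comp_mpoly [tuple t i *: ('X_i : {mpoly k[3]}) | i < 3] g.

Definition actK (k : fieldType) (t : 'I_3 -> k) (f : conefun k) : conefun k :=
  tofrac (act_poly t (\n_(repr f))) / tofrac (act_poly t (\d_(repr f))).

(* On V (x) K the torus acts on both factors, and it preserves RK. *)
Definition actR (k : fieldType) (t : 'I_3 -> k) (v : RKtype k) : RKtype k :=
  vsproj (RK k) (\row_(i < 3) (scalK (t i) * actK t (vsval v 0 i))).

Definition actRdual (k : fieldType) (t : 'I_3 -> k) (l : RKdual k)
    : RKdual k :=
  linfun (fun v : RKtype k =>
    (actK t (l (actR (torusV t) v)) : (conefun k)^o)).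

Definition actDR (k : fieldType) (d : nat) (t : 'I_3 -> k) (phi : formK k d)
    : formK k d :=
  fun l => actK t (phi [ffun i => actRdual (torusV t) (l i)]).

(* Weights of SL_3: the pair (a, b) stands for the class of (a, b, 0) in
   Z^3 / Z(1, 1, 1). *)
Notation weight := (int * int)%type.

Definition omega1 : weight := (1, 0).
Definition omega2 : weight := (1, 1).

Definition lex_le (u v : weight) : Prop :=
  u.1 < v.1 \/ u.1 = v.1 /\ u.2 <= v.2.

(* The variables x_1, x_2, x_3 of A are the coordinates t 0, t 1, t 2. *)
Definition torus_char (k : fieldType) (w : weight) (t : 'I_3 -> k) : k :=
  t 0 ^ w.1 * t 1 ^ w.2.

(* z represents an element of the w-weight space of H^1 (P, D^d R (e)). *)
Definition weight_cocycle (k : fieldType) (d : nat) (e : int) (w : weight)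
    (z : cochain1 k d) : Prop :=
  cocycle1 e z /\
  forall t : 'I_3 -> k, torus t ->
    coboundary1 e
      (fun i j l => actDR t (z i j) l - scalK (torus_char w t) * z i j l).

(* The w-weight space of H^1 (P, D^d R (e)) has dimension r over k: the
   classes of b form a basis. *)
Definition weight_dim (k : fieldType) (d : nat) (e : int) (w : weight) (r : nat)
    : Prop :=
  exists b : 'I_r -> cochain1 k d,
    (forall q, weight_cocycle e w (b q)) /\
    (forall z, weight_cocycle e w z ->
       exists! c : {ffun 'I_r -> k},
         coboundary1 e
           (fun i j l => z i j l - \sum_(q < r) scalK (c q) * b q i j l)).

(* The free abelian group on the weights is the group underlying
   A = Z[x_1^{+-1}, x_2^{+-1}], with (a, b) standing for x_1^a x_2^b. *)
Notation charring := ({freeg weight / int}).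

(* h^1(d, e) = [H^1 (P, D^d R (e - 1))], the unique element whose coefficient
   at each weight is the dimension of the corresponding weight space.  epsilon
   is an arbitrary element if there is no such one, so nothing can be deduced
   about h1 without proving that these dimensions exist. *)
Definition h1 (k : fieldType) (d e : nat) : charring :=
  epsilon (inhabits (0 : charring))
    (fun h => forall w : weight, exists r : nat,
       weight_dim k d (e%:Z - 1) w r /\ coeff w h = r%:Z).

Definition occurs (w : weight) (f : charring) : Prop :=
  coeff w f != 0.

Definition highest_weight (f : charring) (w : weight) : Prop :=
  occurs w f /\ forall u, occurs u f -> lex_le u w.

(* d = m q' + d' and e = m q' + e' with q' = p^s, m > 0 prime to p, and
   0 <= d', e' <= q' - 2 (an inequality of integers, impossible for q' = 1). *)
Definition expansion (p d e s m d' e' : nat) : Prop :=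
  d = (m * p ^ s + d')%N /\ e = (m * p ^ s + e')%N /\ (0 < m)%N /\
  ~~ (p %| m)%N /\ (d' + 2 <= p ^ s)%N /\ (e' + 2 <= p ^ s)%N.

(* Main.v *)
(* The sequence 0 -> D^d R -> D^d V (x) O -> D^(d-1) V (x) O(1) -> 0 and
   H^1(P, O(n)) = 0 identify H^1(P, D^d R(e-1)) with the cokernel of
   delta : D^d V (x) Sym^(e-1) V -> D^(d-1) V (x) Sym^e V.  It is graded by
   u in N^3, |u| = d + e - 1, and a functional mu on the piece of degree u is a
   function of the exponents b <= u, |b| = e, of Sym^e V with
   mu(b + e_1) + mu(b + e_2) + mu(b + e_3) = 0.  Such a mu is determined by the
   values mu(0, b_2, b_3), that is, by a polynomial N of degree at most
   j = d - 1 - u_1, and what remains of the relations is that the coefficients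
   of (1 + z)^(d-j) N vanish in [u_3 - (e - d) - j, u_3].  Hasse derivatives
   remove N: if N has degree t, the binomials C(d, m) vanish in k for
   c - (e - d) <= m <= c, where c = u_3 - t.  Conversely such a c makes
   (d - 1, e - c, c) occur.  Hence the highest weight is given by the smallest
   c, which is 0 if d > e; if d <= e, Lucas' theorem shows that the first run of
   e - d + 1 zeros in row d of the Pascal triangle mod p ends at c = e' + 1. *)
From HB Require Import structures.
Require Import Defs.
From mathcomp Require Import all_boot all_order all_fingroup all_algebra.
From mathcomp Require Import generic_quotient fraction freeg mpoly.
From mathcomp Require Import zify ring.
From Stdlib Require Import ClassicalEpsilon FunctionalExtensionality.
Set Implicit Arguments.
Unset Strict Implicit.
Unset Printing Implicit Defensive.
Import GRing.Theory.
Local Open Scope ring_scope.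

(* [action.actK] shadows the torus action on functions. *)
Local Notation actK := Defs.actK.

(** * Sections of O(e) as Laurent polynomials *)

(** The weight of u is (u_1 - u_3, u_2 - u_3), and u_1 - u_3 = d - 1 - c - (j + t). So the first
    coordinate is at most d - 1 - c, with equality only for j = t = 0, which forces u = (d - 1, e -
    c, c): this is why the smallest c decides the lexicographic order. The window shrinks to
    [c - (e - d), c] in two steps: replacing N by its leading coefficient costs t at the upper end,
    and completing the exponent d - j + t to d costs j - t at the lower end. The inequality t <= j
    holds because the leading coefficient of N is a value of mu, and mu is supported on b_2 <= u_2.
    Minimality of q' enters through d mod p^r, which does not decrease with r: for d <= e every run
    yields an expansion with some p^r such that d mod p^r + (e - d) + 1 <= c. Cocycles are weight
    vectors only up to coboundaries. Hence the comparison with the cokernel has to be equivariant,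
    and characters of the torus have to be separated by points over k; as |u| is fixed, a weight
    then determines u. *)

Section Sections.
Variable k : fieldType.
Implicit Types (e n : int) (I J : {set 'I_3}) (f : conefun k) (G : {mpoly k[3]}).

Lemma I3_cases (i : 'I_3) : [\/ i = 0, i = 1 | i = 2].
Proof.
by case: i => [[|[|[|//]]] h]; [constructor 1|constructor 2|constructor 3]; apply: val_inj.
Qed.

Lemma xK_neq0 i : xK k i != 0.
Proof. by rewrite /xK tofrac_eq0 -msize_poly_eq0 msizeX. Qed.

Lemma tofracX_neq0 m : tofrac ('X_[m] : {mpoly k[3]}) != 0.
Proof. by rewrite tofrac_eq0 -msize_poly_eq0 msizeX. Qed.

Definition indm I : 'X_{1..3} := [multinom (i \in I : nat) | i < 3].

Lemma mdeg_indm I : mdeg (indm I) = #|I|.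
Proof.
rewrite mdegE -sum1_card [RHS]big_mkcond /=; apply: eq_bigr => i _.
by rewrite mnmE; case: (_ \in _).
Qed.

Lemma prod_xK I N : (\prod_(i in I) xK k i) ^+ N = tofrac 'X_[indm I *+ N].
Proof.
rewrite -mpolyXn tofracXn; congr (_ ^+ _); rewrite mpolyXE_id rmorph_prod /=.
rewrite big_mkcond /=; apply: eq_bigr => i _; rewrite mnmE.
by case: (_ \in _); rewrite ?expr1 ?expr0 ?tofrac1.
Qed.

Lemma OO_def e I f : OO e I f <->
  exists g deg N, [/\ g \is deg.-homog, deg%:Z = e + (N * #|I|)%:Z
    & f = tofrac g / tofrac ('X_[indm I *+ N] : {mpoly k[3]})].
Proof.
split=> -[g [deg [N [h1 h2 ->]]]]; exists g, deg, N; split=> //;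
  by rewrite prod_xK.
Qed.

(** The zero numerator still carries a degree e + N |I|, which must be a natural number; for e < 0
    this takes a large N and a nonempty I. *)
Lemma OO0 e I : I != set0 -> OO e I (0 : conefun k).
Proof.
move=> nI; apply/OO_def; exists 0, (absz (e + `|e|%N * #|I|)%R), `|e|%N.
split; rewrite ?rpred0 ?tofrac0 ?mul0r //.
have : (0 < #|I|)%N by rewrite card_gt0.
by move: (#|I|) => c; nia.
Qed.

Lemma OO_add e I f1 f2 : OO e I f1 -> OO e I f2 -> OO e I (f1 + f2).
Proof.
move=> /OO_def[g [dg [N [h1 h2 ->]]]] /OO_def[g' [dg' [N' [h1' h2' ->]]]].
apply/OO_def; exists (g * 'X_[indm I *+ N'] + g' * 'X_[indm I *+ N]).
exists (dg + N' * #|I|)%N, (N + N')%N.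
split; last 1 first.
- rewrite (_ : indm I *+ (N + N') = indm I *+ N + indm I *+ N')%MM; last first.
    by apply/mnmP => i; rewrite mnmDE !mulmnE mulnDr.
  rewrite mpolyXD tofracD !tofracM addf_div ?tofracX_neq0 //.
- apply: rpredD; last rewrite (_ : _ + _ = dg' + N * #|I|)%N; last by lia.
    by apply: dhomogM => //; rewrite dhomogX /= mdegMn mdeg_indm mulnC.
  by apply: dhomogM => //; rewrite dhomogX /= mdegMn mdeg_indm mulnC.
by rewrite mulnDl; lia.
Qed.

Lemma OO_mul e e' I f1 f2 : OO e I f1 -> OO e' I f2 -> OO (e + e') I (f1 * f2).
Proof.
move=> /OO_def[g [dg [N [h1 h2 ->]]]] /OO_def[g' [dg' [N' [h1' h2' ->]]]].
apply/OO_def; exists (g * g'), (dg + dg')%N, (N + N')%N.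
split; first exact: dhomogM.
  by rewrite mulnDl; lia.
rewrite (_ : indm I *+ (N + N') = indm I *+ N + indm I *+ N')%MM; last first.
  by apply/mnmP => i; rewrite mnmDE !mulmnE mulnDr.
by rewrite mpolyXD !tofracM mulf_div.
Qed.

Lemma OO_scal I c : OO 0 I (scalK c : conefun k).
Proof.
apply/OO_def; exists c%:MP, 0%N, 0%N; split=> //.
  by rewrite -alg_mpolyC; apply/rpredZ/dhomog1.
by rewrite mulm0n mpolyX0 tofrac1 divr1.
Qed.

Lemma OO_scalM e I c f : OO e I f -> OO e I (scalK c * f).
Proof. by rewrite -{2}(add0r e); apply: OO_mul; exact: OO_scal. Qed.

Lemma scalKN1 : scalK (-1 : k) = -1.
Proof. by rewrite /scalK mpolyCN tofracN -tofrac1. Qed.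

Lemma OO_opp e I f : OO e I f -> OO e I (- f).
Proof. by rewrite -mulN1r -scalKN1; exact: OO_scalM. Qed.

Lemma OO_sub e I f1 f2 : OO e I f1 -> OO e I f2 -> OO e I (f1 - f2).
Proof. by move=> h1 h2; apply: OO_add => //; exact: OO_opp. Qed.

Lemma OO_sum e I (T : Type) (r : seq T) (P : pred T) (F : T -> conefun k) :
  I != set0 -> (forall t, P t -> OO e I (F t)) -> OO e I (\sum_(t <- r | P t) F t).
Proof.
move=> nI h; elim/big_rec: _ => [|t f Pt ih]; first exact: OO0.
by apply: OO_add => //; exact: h.
Qed.

Lemma OO_X (e : nat) I g : g \is e.-homog -> OO e I (tofrac g : conefun k).
Proof.
move=> h; apply/OO_def; exists g, e, 0%N; split=> //; first by rewrite mul0n addr0.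
by rewrite mulm0n mpolyX0 tofrac1 divr1.
Qed.

Lemma OO_x I i : OO 1 I (xK k i).
Proof. by apply: OO_X; rewrite dhomogX /= mdeg1. Qed.

Lemma OO_xV I i : i \in I -> OO (-1) I (xK k i)^-1.
Proof.
move=> iI; apply/OO_def; exists 'X_[indm (I :\ i)], #|I :\ i|, 1%N.
split; first by rewrite dhomogX /= mdeg_indm.
  by rewrite (cardsD1 i I) iI; lia.
rewrite mulm1n (_ : indm I = U_(i) + indm (I :\ i))%MM; last first.
  apply/mnmP => j; rewrite mnmDE mnm1E !mnmE !inE eq_sym.
  by case: eqP => [->|_]; rewrite ?iI.
by rewrite mpolyXD tofracM invfM mulrCA divff ?mulr1 // tofracX_neq0.
Qed.

Lemma OO_mono e I J f : I \subset J -> OO e I f -> OO e J f.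
Proof.
move=> IJ /OO_def[g [dg [N [h1 h2 ->]]]].
apply/OO_def; exists (g * 'X_[indm (J :\: I) *+ N]), (dg + #|J :\: I| * N)%N, N.
split; first by apply: dhomogM => //; rewrite dhomogX /= mdegMn mdeg_indm.
  by have := cardsID I J; rewrite (setIidPr IJ) => <-; rewrite mulnDr; lia.
rewrite (_ : indm J = indm I + indm (J :\: I))%MM; last first.
  apply/mnmP => j; rewrite mnmDE !mnmE !inE.
  by have := subsetP IJ j; case: (j \in I) => [->|_].
rewrite (_ : (_ + _) *+ N = indm I *+ N + indm (J :\: I) *+ N)%MM; last first.
  by apply/mnmP => j; rewrite !(mnmDE, mulmnE) mulnDl.
by rewrite mpolyXD !tofracM -mulf_div divff ?mulr1 // tofracX_neq0.
Qed.

Definition cstm N : 'X_{1..3} := [multinom N | i < 3].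

(* Every section over an intersection of the D+(x_i) is G / (x_0 x_1 x_2)^N for
   large N; [good] lists the monomials that G may contain. *)
Definition Lau N G : conefun k := tofrac G / tofrac 'X_[cstm N].

Definition good e I N G :=
  forall m, m \in msupp G -> (mdeg m)%:Z = e + (3 * N)%:Z /\ forall i, i \notin I -> (N <= m i)%N.

Lemma mdeg_cstm N : mdeg (cstm N) = (3 * N)%N.
Proof. by rewrite mdegE !big_ord_recl big_ord0 !mnmE; lia. Qed.

Lemma cstmD N M : cstm (N + M) = (cstm N + cstm M)%MM.
Proof. by apply/mnmP => i; rewrite mnmDE !mnmE. Qed.

Lemma LauD N M G : Lau N G = Lau (N + M) (G * 'X_[cstm M]).
Proof.
by rewrite /Lau cstmD mpolyXD !tofracM -mulf_div divff ?mulr1 // tofracX_neq0.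
Qed.

Lemma Lau_is_additive N : zmod_morphism (Lau N).
Proof. by move=> a b; rewrite /Lau tofracB mulrBl. Qed.

Lemma Lau_inj N G G' : Lau N G = Lau N G' -> G = G'.
Proof.
move=> h; apply/eqP; rewrite -tofrac_eq; apply/eqP; move: h.
by apply: mulIf; rewrite invr_eq0 tofracX_neq0.
Qed.

Lemma msuppMX_mem G m a : m \in msupp G -> (a + m)%MM \in msupp (G * 'X_[a]).
Proof. by rewrite !mcoeff_msupp mcoeffMX. Qed.

Lemma msuppMXP G a m : m \in msupp (G * 'X_[a]) -> exists2 m', m' \in msupp G & m = (a + m')%MM.
Proof. by rewrite (perm_mem (msuppMX _ _)) => /mapP. Qed.

(** Every large N is allowed, so that several sections can be put over one denominator. *)
Lemma OO_Lau e I f : OO e I f ->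
  exists N0, forall N, (N0 <= N)%N -> exists2 G, f = Lau N G & good e I N G.
Proof.
move=> /OO_def[g [dg [N0 [h1 h2 ->]]]]; exists N0 => N le.
have good0 : good e I N0 (g * 'X_[indm (~: I) *+ N0]).
  move=> _ /msuppMXP[m mg ->]; split.
    rewrite mdegD mdegMn mdeg_indm; have /dhomogP/(_ m mg) /= := h1.
    have := cardsC I; rewrite card_ord /= => h3 h4.
    have e3 : (3 * N0 = #|I| * N0 + #|~: I| * N0)%N by rewrite -mulnDl h3.
    move: e3 h2; rewrite h4 [(N0 * _)%N]mulnC.
    by move: (#|I| * N0)%N (#|~: I| * N0)%N => u v; lia.
  by move=> i iI; rewrite mnmDE mulmnE mnmE inE iI mul1n leq_addr.
exists (g * 'X_[indm (~: I) *+ N0] * 'X_[cstm (N - N0)]).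
  rewrite -{1}(subnKC le) -LauD /Lau.
  rewrite (_ : cstm N0 = indm I *+ N0 + indm (~: I) *+ N0)%MM; last first.
    apply/mnmP => j; rewrite !(mnmDE, mulmnE) !mnmE !inE.
    by case: (j \in I); rewrite /= !(mul1n, mul0n) ?addn0.
  by rewrite mpolyXD !tofracM -mulf_div divff ?mulr1 // tofracX_neq0.
move=> _ /msuppMXP[m /good0[h3 h4] ->]; split.
  by rewrite mdegD mdeg_cstm; lia.
move=> i /h4; rewrite mnmDE mnmE; lia.
Qed.

(** [OO_Lau] controls some numerator over some denominator. Over the exponent N + N' it agrees with
    G up to monomial factors, and [good] is insensitive to these. *)
Lemma OO_good e I N G : OO e I (Lau N G) -> good e I N G.
Proof.
move=> /OO_Lau[N' /(_ _ (leqnn _))[G' + g']] m mG.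
rewrite (LauD N N') (LauD N' N) [(N' + N)%N]addnC => /Lau_inj h.
have := msuppMX_mem (cstm N') mG; rewrite h => /msuppMXP[m' /g'[h1 h2] em].
have emi i : (N' + m i = N + m' i)%N by have /mnmP/(_ i) := em; rewrite !mnmDE !mnmE.
split; last by move=> i /h2; have := emi i; lia.
by have := congr1 (@mdeg 3) em; rewrite !mdegD !mdeg_cstm; lia.
Qed.

Lemma good_OO e I N G : I != set0 -> good e I N G -> OO e I (Lau N G).
Proof.
move=> nI gG; have [->|nG] := eqVneq G 0.
  by rewrite /Lau tofrac0 mul0r; exact: OO0.
(* The part of the denominator away from I; it divides every monomial of G and cancels. *)
pose a := (indm (~: I) *+ N)%MM.
have la m : m \in msupp G -> (a <= m)%MM.
  move=> /gG[_ h]; apply/mnm_lepP => i; rewrite mulmnE mnmE inE.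
  by case: (boolP (i \in I)) => [|/h]; rewrite ?mul1n ?mul0n.
pose g := \sum_(m <- msupp G) G@_m *: 'X_[m - a].
have eG : G = g * 'X_[a].
  rewrite mulr_suml {1}(mpolyE G) big_seq [RHS]big_seq; apply: eq_bigr => m mG.
  by rewrite -scalerAl -mpolyXD submK // la.
have cI := cardsC I; rewrite card_ord in cI.
have dm m : m \in msupp G -> (mdeg (m - a))%:Z = e + (N * #|I|)%:Z.
  move=> mG; have := congr1 (@mdeg 3) (submK (la m mG)).
  have [h _] := gG m mG; rewrite mdegD /a mdegMn mdeg_indm => h3; nia.
have [m0 m0G] : exists m0, m0 \in msupp G.
  exists (mlead G); exact: mlead_supp.
apply/OO_def; exists g, (mdeg (m0 - a)), N; split; last 1 first.
- rewrite /Lau {1}eG (_ : cstm N = indm I *+ N + a)%MM; last first.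
    apply/mnmP => j; rewrite !(mnmDE, mulmnE) !mnmE !inE.
    by case: (j \in I); rewrite /= !(mul1n, mul0n) ?addn0.
  by rewrite mpolyXD !tofracM -mulf_div divff ?mulr1 // tofracX_neq0.
- rewrite /g big_seq; apply: rpred_sum => m mG; apply: rpredZ.
  rewrite dhomogX /=; apply/eqP; have := dm m mG; have := dm m0 m0G; lia.
exact: dm.
Qed.

Definition filtm (P : pred 'X_{1..3}) G := \sum_(m <- msupp G | P m) G@_m *: 'X_[m].

Lemma mcoeff_filtm P G m : (filtm P G)@_m = if P m then G@_m else 0.
Proof.
rewrite /filtm raddf_sum /=; under eq_bigr do rewrite mcoeffZ mcoeffX.
case: (boolP (m \in msupp G)) => mG.
  rewrite big_mkcond (bigD1_seq m) //= ?msupp_uniq // eqxx mulr1.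
  rewrite big1 ?addr0; first by case: (P m).
  by move=> i /negbTE ->; rewrite mulr0 if_same.
rewrite (memN_msupp_eq0 mG) if_same big_seq_cond big1 // => i /andP[iG _].
by case: eqP => [ei|_]; rewrite ?mulr0 //; move: mG; rewrite -ei iG.
Qed.

(* With a common denominator, the part of s 0 1 with poles along x_0 agrees with
   that of s 0 2, because s 1 2 has no such poles; subtracting it splits s. *)
Lemma cech1_OO e (s : 'I_3 -> 'I_3 -> conefun k) :
  (forall i j, OO e [set i; j] (s i j)) ->
  (forall i j m, s j m - s i m + s i j = 0) ->
  exists c : 'I_3 -> conefun k,
    (forall i, OO e [set i] (c i)) /\ (forall i j, s i j = c j - c i).
Proof.
move=> sO sC.
have s00 i : s i i = 0 by have := sC i i i; rewrite subrr add0r.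
have [N1 /(_ (maxn _ _) (leq_maxl N1 _)) h1] := OO_Lau (sO 0 1).
have [N2 /(_ (maxn _ _) (leq_maxr _ N2)) h2] := OO_Lau (sO 0 2).
have {h1} [G1 e1 g1] := h1 N2; have {h2} [G2 e2 g2] := h2 N1.
move: (maxn N1 N2) e1 e2 g1 g2 => N e1 e2 g1 g2.
have g12 : good e [set 1; 2] N (G2 - G1).
  apply: OO_good; rewrite Lau_is_additive -e1 -e2; have := sO 1 2.
  by rewrite (_ : s 1 2 = s 0 2 - s 0 1) //; apply/eqP; rewrite -subr_eq0 opprB addrA addrAC sC.
have eqG (m : 'X_{1..3}) : (m 0%R < N)%N -> G1@_m = G2@_m.
  move=> hm; apply/eqP; rewrite eq_sym -subr_eq0 -mcoeffB mcoeff_eq0.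
  by apply/negP => /g12[_ /(_ 0)]; rewrite !inE => /(_ isT); lia.
pose F := filtm (fun m : 'X_{1..3} => m 0%R < N)%N G1.
exists (fun i => s 0 i - Lau N F); split; last first.
  move=> i j; rewrite opprB addrA subrK; apply/eqP.
  by rewrite -subr_eq0 opprB addrA addrAC sC.
have n1 i : [set i : 'I_3] != set0 by apply/set0Pn; exists i; rewrite set11.
move=> i; case: (I3_cases i) => ->.
(* A monomial of F occurs in G1 and in G2: the former excludes poles along x_2, the latter along
   x_1. *)
- rewrite s00 sub0r; apply: OO_opp; apply: good_OO => // m.
  rewrite mcoeff_msupp mcoeff_filtm; case: ifP => [hm|]; last by rewrite eqxx.
  move=> c1; have mG1 : m \in msupp G1 by rewrite mcoeff_msupp.
  have [dm h1] := g1 m mG1.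
  have mG2 : m \in msupp G2 by rewrite mcoeff_msupp -eqG.
  have [_ h2] := g2 m mG2.
  split=> // j; case: (I3_cases j) => ->; rewrite !inE ?eqxx //.
    by move=> _; apply: h2; rewrite !inE.
  by move=> _; apply: h1; rewrite !inE.
- rewrite e1 -Lau_is_additive; apply: good_OO => // m.
  rewrite mcoeff_msupp mcoeffB mcoeff_filtm; case: ifP => [hm|]; first by rewrite subrr eqxx.
  move=> hm; rewrite subr0 => c1; have mG1 : m \in msupp G1 by rewrite mcoeff_msupp.
  have [dm h1] := g1 m mG1.
  split=> // j; case: (I3_cases j) => ->; rewrite !inE ?eqxx //; first by move=> _; lia.
  by move=> _; apply: h1; rewrite !inE.
rewrite e2 -Lau_is_additive; apply: good_OO => // m.
rewrite mcoeff_msupp mcoeffB mcoeff_filtm; case: ifP => [hm|].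
  by rewrite -eqG // subrr eqxx.
move=> hm; rewrite subr0 => c1; have mG2 : m \in msupp G2 by rewrite mcoeff_msupp.
  have [dm h1] := g2 m mG2.
split=> // j; case: (I3_cases j) => ->; rewrite !inE ?eqxx //; first by move=> _; lia.
by move=> _; apply: h1; rewrite !inE.
Qed.

(** Poles along x_i are excluded by regularity on some D+(x_j) with j different from i. *)
Lemma OO_global e f : (forall i, OO e [set i] f) ->
  exists2 G, f = tofrac G & forall m, m \in msupp G -> (mdeg m)%:Z = e.
Proof.
move=> h; have [N /(_ _ (leqnn _))[G eG gG]] := OO_Lau (h 0).
have lN m i : m \in msupp G -> (N <= m i)%N.
  move=> mG; have [->|ni] := eqVneq i 0.
    by move: (h 1); rewrite eG => /OO_good/(_ m mG)[_]; apply; rewrite inE.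
  by have [_ ->] := gG m mG; rewrite ?inE.
exists (\sum_(m <- msupp G) G@_m *: 'X_[m - cstm N]).
  rewrite eG /Lau {1}(mpolyE G); apply: (mulIf (tofracX_neq0 (cstm N))).
  rewrite divfK ?tofracX_neq0 // -tofracM mulr_suml; congr tofrac.
  rewrite big_seq [RHS]big_seq; apply: eq_bigr => m mG.
  rewrite -scalerAl -mpolyXD submK //.
  by apply/mnm_lepP => i; rewrite mnmE lN.
move=> m' /msupp_sum_le/flattenP[s /mapP[m]]; rewrite mem_filter /= => mG -> {s}.
move=> /msuppZ_le; rewrite msuppX inE => /eqP->.
have [dm _] := gG m mG.
have /(congr1 (@mdeg 3)) : (m - cstm N + cstm N = m)%MM.
  by rewrite submK //; apply/mnm_lepP => i; rewrite mnmE lN.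
by rewrite mdegD mdeg_cstm; lia.
Qed.
End Sections.

(** * Coordinates on D^d R *)

Lemma linfunE (F : fieldType) (aT rT : vectType F) (f : aT -> rT) :
  linear f -> linfun f =1 f.
Proof.
move=> lf; pose m := GRing.isLinear.Build _ _ _ _ f lf.
pose g : {linear aT -> rT} := HB.pack f m.
exact: lfunE g.
Qed.

Section Forms.
Variable k : fieldType.
Implicit Types (i j : 'I_3) (l : RKdual k) (f : 'X_{1..3} -> conefun k).

Lemma RKE (v : 'rV[conefun k]_3) : (v \in RK k) = (\sum_j v 0 j * xK k j == 0).
Proof.
rewrite memv_ker lfunE /=; apply/eqP/eqP => [/matrixP/(_ 0 0)|h].
  by rewrite !mxE => h; rewrite -[RHS]h; apply: eq_bigr => j _; rewrite !mxE.
apply/matrixP=> a b; rewrite !ord1 !mxE -[RHS]h; apply: eq_bigr => j _.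
by rewrite !mxE.
Qed.

Lemma RK_rel (v : RKtype k) : \sum_j vsval v 0 j * xK k j = 0.
Proof. by apply/eqP; rewrite -RKE subvsP. Qed.

(** The images of the dual basis under the surjection from the dual of V (x) K to the dual of R. *)
Definition epsR j : RKdual k :=
  linfun (fun v : RKtype k => (vsval v 0 j : (conefun k)^o)).

Lemma epsRE j v : epsR j v = vsval v 0 j.
Proof. by rewrite linfunE // => a u w; rewrite linearP !mxE. Qed.

Lemma sum_epsR : \sum_j xK k j *: epsR j = 0.
Proof.
apply/lfunP => v; rewrite sum_lfunE zero_lfunE -[RHS](RK_rel v).
by apply: eq_bigr => j _; rewrite scale_lfunE epsRE mulrC.
Qed.

(* The image of e_j under the projection of V (x) K onto R along e_i; it is
   regular over D+(x_i). *)
Definition vecR i j : RKtype k :=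
  vsproj (RK k) (delta_mx 0 j - (xK k j / xK k i) *: delta_mx 0 i).

Lemma vecRE i j q : vsval (vecR i j) 0 q = (q == j)%:R - (xK k j / xK k i) * (q == i)%:R.
Proof.
have sumd (g : 'I_3 -> conefun k) j0 : \sum_q (q == j0)%:R * g q = g j0.
  rewrite (bigD1 j0) //= eqxx mul1r big1 ?addr0 // => a /negbTE->.
  by rewrite mul0r.
rewrite /vecR vsprojK ?RKE ?mxE //=.
apply/eqP; under eq_bigr => a _ do
  rewrite !mxE /= mulrBl -[(xK k j / xK k i) * _ * _]mulrA.
by rewrite sumrB sumd -mulr_sumr sumd divfK ?subrr // xK_neq0.
Qed.

Lemma decompR i (v : RKtype k) : v = \sum_j vsval v 0 j *: vecR i j.
Proof.
apply/val_inj/rowP => q; rewrite /= linear_sum /= summxE.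
under eq_bigr => j _ do rewrite mxE vecRE mulrBr.
rewrite sumrB (bigD1 q) //= eqxx mulr1 [X in _ + X - _]big1 ?addr0; last first.
  by move=> j /negbTE; rewrite eq_sym => ->; rewrite mulr0.
rewrite (_ : \sum_j _ = (\sum_j vsval v 0 j * xK k j) * ((xK k i)^-1 * (q == i)%:R)).
  by rewrite RK_rel mul0r subr0.
by rewrite mulr_suml; apply: eq_bigr => j _; rewrite !mulrA.
Qed.

(** The point of these coefficients is that they are regular over U_I for i in I whenever l is, by
    [secR_vecR]. *)
Lemma decompRdual i l : l = \sum_j (l (vecR i j) : conefun k) *: epsR j.
Proof.
apply/lfunP => v; rewrite {1}(decompR i v) linear_sum sum_lfunE.
apply: eq_bigr => j _; rewrite linearZ scale_lfunE epsRE.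
by rewrite /GRing.scale /= mulrC.
Qed.

(* If f gives the coordinates f_a of sum_a f_a x^(a) in D^d V, then contr i s f 0
   is the value on s of the corresponding symmetric form, each argument l being
   written as sum_j l(vecR i j) eps_j. *)
Fixpoint contr i (s : seq (RKdual k)) f (a : 'X_{1..3}) : conefun k :=
  if s is l :: s' then \sum_j (l (vecR i j) : conefun k) * contr i s' f (a + U_(j))%MM
  else f a.

Lemma contr_catCA i l1 l2 s f a : contr i (l1 :: l2 :: s) f a = contr i (l2 :: l1 :: s) f a.
Proof.
rewrite /=; under eq_bigr do rewrite mulr_sumr.
rewrite exchange_big /=; apply: eq_bigr => j _; rewrite mulr_sumr.
apply: eq_bigr => q _; rewrite mulrCA; congr (_ * (_ * contr _ _ _ _)).
by rewrite -!addmA [(U_(q) + _)%MM]addmC.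
Qed.

Lemma contr_perm i s t f a : perm_eq s t -> contr i s f a = contr i t f a.
Proof.
elim: s t a => [t a|l s IH t a].
  by rewrite perm_sym => /perm_nilP->.
move=> st; have lt : l \in t by rewrite -(perm_mem st) mem_head.
transitivity (contr i (l :: rem l t) f a).
  rewrite /=; apply: eq_bigr => j _; congr (_ * _); apply: IH.
  by rewrite -(perm_cons l) (perm_trans st) // perm_to_rem.
elim: t lt a {st IH} => // l' t IH lt a /=.
case: eqP => [->//|/eqP nl].
rewrite -[LHS]/(contr i (l :: l' :: rem l t) f a) contr_catCA.
apply: eq_bigr => j _; congr (_ * _); apply: IH.
by move: lt; rewrite inE eq_sym (negbTE nl).
Qed.

Lemma contr_lin i (c : conefun k) l1 l2 s f a :
  contr i (c *: l1 + l2 :: s) f a = c * contr i (l1 :: s) f a + contr i (l2 :: s) f a.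
Proof.
rewrite /= mulr_sumr -big_split /=; apply: eq_bigr => j _.
by rewrite add_lfunE scale_lfunE mulrA -mulrDl.
Qed.

Variable d : nat.

(** Under [rel0 f] the form does not depend on i, by [crd_symform] and [crd_inj]; i is chosen so
    that x_i is invertible where regularity is wanted. *)
Definition symform i f : formK k d :=
  fun L => contr i [seq L q | q <- enum 'I_d] f 0%MM.

(* The kernel of D^d V (x) O(e) -> D^(d-1) V (x) O(e + 1), in coordinates. *)
Definition rel0 f :=
  forall a : 'X_{1..3}, (mdeg a).+1 = d -> \sum_j xK k j * f (a + U_(j))%MM = 0.

Lemma symform_sym i f : sym_multilinear (symform i f).
Proof.
split=> [l q c u v|l s].
  have h w : contr i [seq upd l q w m | m <- enum 'I_d] f 0%MM
      = contr i (w :: [seq l m | m <- rem q (enum 'I_d)]) f 0%MM.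
    apply: contr_perm.
    have /(perm_map (upd l q w)) := perm_to_rem (mem_enum 'I_d q).
    move=> /perm_trans; apply; rewrite /= ffunE eqxx perm_cons.
    have -> : map (upd l q w) (rem q (enum 'I_d)) = map l (rem q (enum 'I_d)).
      apply/eq_in_map => m; rewrite mem_rem_uniq ?enum_uniq // inE.
      by case/andP=> /negbTE h _; rewrite ffunE h.
    exact: perm_refl.
  by rewrite /symform !h contr_lin.
apply: contr_perm.
rewrite (@eq_map _ _ _ (l \o s)); last by move=> m; rewrite ffunE.
rewrite map_comp; apply: perm_map; apply: uniq_perm.
- by rewrite map_inj_uniq ?enum_uniq //; apply: perm_inj.
- exact: enum_uniq.
move=> m; rewrite mem_enum; apply/mapP; exists (s^-1%g m); rewrite ?mem_enum //.
by rewrite permKV.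
Qed.

(** With a list of arguments, consing, concatenation and permutation need no dependent types. *)
Definition phis (phi : formK k d) (s : seq (RKdual k)) : conefun k :=
  phi [ffun q : 'I_d => nth 0 s q].

Lemma phis_perm phi s t : sym_multilinear phi -> size s = d -> perm_eq s t ->
  phis phi s = phis phi t.
Proof.
move=> [_ sym] ss st; have tt : size t = d by rewrite -(perm_size st).
have st' : perm_eq (in_tuple s) (in_tuple t) by [].
pose T : d.-tuple (RKdual k) := tcast tt (in_tuple t).
have st2 : perm_eq s T by rewrite val_tcast.
have [p ep] := tuple_permP st2.
rewrite /phis -(sym [ffun q : 'I_d => nth 0 t q] p); congr (phi _).
apply/ffunP => q; rewrite !ffunE ep -tnth_nth tnth_mktuple.
by rewrite (tnth_nth 0) val_tcast.
Qed.

Lemma phis_lin phi (c : conefun k) l1 l2 s : sym_multilinear phi -> (size s).+1 = d ->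
  phis phi (c *: l1 + l2 :: s) = c * phis phi (l1 :: s) + phis phi (l2 :: s).
Proof.
move=> [lin _] sd; have d0 : (0 < d)%N by rewrite -sd.
have h l : [ffun q : 'I_d => nth 0 (l :: s) q]
    = upd [ffun q : 'I_d => nth 0 (0 :: s) q] (Ordinal d0) l.
  by apply/ffunP => q; rewrite !ffunE; case: q => [[|q] hq].
by rewrite /phis (h (c *: l1 + l2)) (h l1) (h l2) lin.
Qed.

Lemma phis_sum phi s (c : 'I_3 -> conefun k) (L : 'I_3 -> RKdual k) :
  sym_multilinear phi -> (size s).+1 = d ->
  phis phi (\sum_j c j *: L j :: s) = \sum_j c j * phis phi (L j :: s).
Proof.
move=> sm sd.
have z0 : phis phi (0 :: s) = 0.
  have := phis_lin 1 0 0 sm sd; rewrite scaler0 addr0 mul1r => h.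
  by apply: (addrI (phis phi (0 :: s))); rewrite -h addr0.
elim: (index_enum _) => [|j r IH]; first by rewrite !big_nil.
by rewrite !big_cons phis_lin // IH.
Qed.

Definition mons (a : 'X_{1..3}) : seq 'I_3 := flatten [seq nseq (a j) j | j <- enum 'I_3].
Definition cntm (M : seq 'I_3) : 'X_{1..3} := [multinom count_mem j M | j < 3].

Lemma cntm_cons j M : cntm (j :: M) = (U_(j) + cntm M)%MM.
Proof. by apply/mnmP => q; rewrite mnmDE mnm1E !mnmE /=. Qed.

Lemma cntm_perm M M' : perm_eq M M' <-> cntm M = cntm M'.
Proof.
split=> [/seq.permP h|/mnmP h]; first by apply/mnmP => q; rewrite !mnmE h.
by apply/allP => q _ /=; have := h q; rewrite !mnmE => ->.
Qed.

Lemma cntm_mons a : cntm (mons a) = a.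
Proof.
apply/mnmP => q; rewrite mnmE /mons count_flatten -map_comp sumnE big_map big_enum /=.
rewrite (bigD1 q) //= count_nseq /= eqxx mul1n big1 ?addn0 // => j /negbTE h.
by rewrite count_nseq /= h.
Qed.

Lemma mdeg_cntm M : mdeg (cntm M) = size M.
Proof.
elim: M => [|j M IH]; last by rewrite cntm_cons mdegD mdeg1 IH.
by apply/eqP; rewrite mdeg_eq0; apply/eqP/mnmP => q; rewrite !mnmE.
Qed.

Lemma size_mons a : size (mons a) = mdeg a.
Proof. by rewrite -mdeg_cntm cntm_mons. Qed.

Definition crd (phi : formK k d) (a : 'X_{1..3}) : conefun k :=
  phis phi [seq epsR j | j <- mons a].

Lemma crdE phi M : sym_multilinear phi -> size M = d ->
  phis phi [seq epsR j | j <- M] = crd phi (cntm M).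
Proof.
move=> sm sM; apply: phis_perm => //; first by rewrite size_map.
by apply/perm_map/cntm_perm; rewrite cntm_mons.
Qed.

Lemma phis_contr i phi s M : sym_multilinear phi -> (size s + size M)%N = d ->
  phis phi (s ++ [seq epsR j | j <- M]) = contr i s (crd phi) (cntm M).
Proof.
move=> sm; elim: s M => [|l s IH] M sM; first exact: crdE.
rewrite /= {1}(decompRdual i l) phis_sum //; last first.
  by rewrite size_cat size_map.
apply: eq_bigr => j _; congr (_ * _).
rewrite addmC -cntm_cons -IH //=; last by rewrite addnS.
apply: phis_perm => //=; first by rewrite size_cat size_map.
exact: permEl (perm_catCA [:: epsR j] s _).
Qed.

Lemma symform_crd i phi L : sym_multilinear phi -> symform i (crd phi) L = phi L.
Proof.
move=> sm; rewrite /symform.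
rewrite -[in RHS](_ : [ffun q : 'I_d => nth 0 [seq L q | q <- enum 'I_d] q] = L).
  rewrite (_ : 0%MM = cntm [::]); last by apply/mnmP => q; rewrite !mnmE.
  by rewrite -phis_contr ?cats0 // size_map size_enum_ord addn0.
apply/ffunP => q; rewrite ffunE (nth_map q) ?size_enum_ord //.
by rewrite nth_ord_enum.
Qed.

Lemma crd_inj phi psi : sym_multilinear phi -> sym_multilinear psi ->
  (forall a, mdeg a = d -> crd phi a = crd psi a) -> phi =1 psi.
Proof.
move=> sphi spsi h L; rewrite -(symform_crd 0 L sphi) -(symform_crd 0 L spsi) /symform.
have : (size [seq L q | q <- enum 'I_d] + mdeg (0%MM : 'X_{1..3}))%N = d.
  by rewrite size_map size_enum_ord mdeg0 addn0.
elim: [seq _ | _ <- _] 0%MM => [|l s IH] a /= sd; first by rewrite h.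
by apply: eq_bigr => j _; rewrite IH // mdegD mdeg1 addn1 addnS.
Qed.

(** Evaluate phi with one argument equal to the vanishing sum of [sum_epsR]. *)
Lemma crd_rel0 phi : sym_multilinear phi -> rel0 (crd phi).
Proof.
move=> sm a ad.
transitivity (phis phi (\sum_j xK k j *: epsR j :: [seq epsR j | j <- mons a])).
  rewrite phis_sum ?size_map ?size_mons //; apply: eq_bigr => j _; congr (_ * _).
  rewrite -map_cons crdE ?cntm_cons ?cntm_mons ?[(a + _)%MM]addmC //=.
  by rewrite size_mons.
have -> : \sum_j xK k j *: epsR j = \sum_j 0 *: epsR j.
  by rewrite sum_epsR big1 // => j _; rewrite scale0r.
by rewrite phis_sum ?size_map ?size_mons // big1 // => j _; rewrite mul0r.
Qed.

(** The value of eps_m on [vecR i j] is [m = j] - (x_j / x_i) [m = i]; the second terms add up to a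
    multiple of the relation [rel0]. *)
Lemma contr_eps i M f a : rel0 f -> (mdeg a + size M)%N = d ->
  contr i [seq epsR j | j <- M] f a = f (a + cntm M)%MM.
Proof.
move=> rf; elim: M a => [|m M IH] a sd /=.
  by congr f; apply/mnmP => q; rewrite mnmDE mnmE /= addn0.
under eq_bigr => j _.
  rewrite IH; last by rewrite mdegD mdeg1 -sd /= addn1 addnS.
  rewrite epsRE vecRE mulrBl; over.
rewrite sumrB (bigD1 m) //= eqxx mul1r [X in _ + X - _]big1 ?addr0; last first.
  by move=> j /negbTE; rewrite eq_sym => ->; rewrite mul0r.
rewrite (_ : \sum_j _ = (\sum_j xK k j * f (a + cntm M + U_(j))%MM) * ((xK k i)^-1 * (m == i)%:R)).
  rewrite rf ?mul0r ?subr0; first by rewrite cntm_cons addmA.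
  by rewrite mdegD mdeg_cntm -sd /= addnS.
rewrite mulr_suml; apply: eq_bigr => j _.
rewrite -!addmA [(cntm M + _)%MM]addmC -!mulrA; congr (_ * _).
by rewrite [RHS]mulrC -mulrA.
Qed.

Lemma crd_symform i f a : rel0 f -> mdeg a = d -> crd (symform i f) a = f a.
Proof.
move=> rf ad; rewrite /crd /phis /symform.
have -> : [seq [ffun q : 'I_d => nth 0 [seq epsR j | j <- mons a] q] q | q <- enum 'I_d]
   = [seq epsR j | j <- mons a].
  apply: (@eq_from_nth _ 0); first by rewrite size_map [RHS]size_map size_mons size_enum_ord.
  move=> n; rewrite size_map size_enum_ord => nd.
  rewrite (nth_map (Ordinal nd)) ?size_enum_ord // ffunE.
  by rewrite nth_enum_ord.
rewrite contr_eps //; last by rewrite mdeg0 size_mons.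
by rewrite cntm_mons add0m.
Qed.

Lemma secRdual_eps I j : secRdual I (epsR j).
Proof. by move=> v hv; rewrite epsRE; exact: hv. Qed.

Lemma crd_OO e I phi a : secDR e I phi -> OO e I (crd phi a).
Proof.
move=> [sm h]; apply: h => q; rewrite ffunE.
have [hq|hq] := ltnP q (size (mons a)).
  by rewrite (nth_map 0) //; exact: secRdual_eps.
rewrite nth_default ?size_map // => v hv.
rewrite zero_lfunE.
(* As I may be empty, [OO0] does not apply; degree and exponent are borrowed from a coordinate of
   v. *)
have := hv 0 => -[g [dg [N [h1 h2 _]]]]; exists 0, dg, N.
by rewrite rpred0 tofrac0 mul0r.
Qed.

Lemma secR_vecR (I : {set 'I_3}) i j : i \in I -> secR I (vecR i j).
Proof.
move=> iI q; rewrite vecRE.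
have one (b : bool) : OO 0 I (b%:R : conefun k).
  by have := OO_scal I (b%:R : k); rewrite /scalK mpolyC_nat rmorph_nat.
apply: OO_sub; first exact: one.
rewrite -(add0r 0); apply: OO_mul; last exact: one.
by rewrite -[X in OO X](addrN 1); apply: OO_mul; [exact: OO_x|exact: OO_xV].
Qed.

Lemma symform_sec e (I : {set 'I_3}) i f : i \in I -> (forall a, mdeg a = d -> OO e I (f a)) ->
  secDR e I (symform i f).
Proof.
move=> iI fO; split; first exact: symform_sym.
move=> L LO; rewrite /symform.
have nI : I != set0 by apply/set0Pn; exists i.
have : {in [seq L q | q <- enum 'I_d], forall l, secRdual I l}.
  by move=> l /mapP[q _ ->].
have : (size [seq L q | q <- enum 'I_d] + mdeg (0%MM : 'X_{1..3}))%N = d.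
  by rewrite size_map size_enum_ord mdeg0 addn0.
elim: [seq _ | _ <- _] 0%MM => [|l s IH] a /= sd hs; first exact: fO.
apply: OO_sum => // j _; rewrite -(add0r e); apply: OO_mul.
  by apply: (hs l (mem_head _ _)); exact: secR_vecR.
apply: IH; first by rewrite mdegD mdeg1 addn1 addnS.
by move=> l' h; apply: hs; rewrite inE h orbT.
Qed.
End Forms.

(** * The torus action *)

Section Torus.
Variable k : fieldType.
Implicit Types (t : 'I_3 -> k) (f : conefun k) (g h : {mpoly k[3]}).

Definition monK t (m : 'X_{1..3}) : k := \prod_i t i ^+ m i.

Lemma monKD t m1 m2 : monK t (m1 + m2)%MM = monK t m1 * monK t m2.
Proof. by rewrite -big_split; apply: eq_bigr => i _; rewrite mnmDE exprD. Qed.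

Lemma monK1 t i : monK t U_(i)%MM = t i.
Proof.
rewrite /monK (bigD1 i) //= mnm1E eqxx expr1 big1 ?mulr1 // => j.
by rewrite mnm1E eq_sym => /negbTE->.
Qed.

Lemma monKV t m : monK (torusV t) m = (monK t m)^-1.
Proof. by rewrite -prodfV; apply: eq_bigr => i _; rewrite exprVn. Qed.

Lemma torus_neq0 t i : torus t -> t i != 0.
Proof.
by move=> h; apply/negP => /eqP t0; move/eqP: h; rewrite (bigD1 i) //= t0 mul0r eq_sym oner_eq0.
Qed.

Lemma torusVP t : torus t -> torus (torusV t).
Proof. by rewrite /torus => h; rewrite prodfV h invr1. Qed.

Lemma torusVK t : torusV (torusV t) = t.
Proof. by apply: functional_extensionality => i; rewrite /torusV invrK. Qed.

Lemma monK_neq0 t m : torus t -> monK t m != 0.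
Proof.
by move=> h; apply/prodf_neq0 => i _; rewrite expf_neq0 // torus_neq0.
Qed.

Lemma act_polyX t m : act_poly t 'X_[m] = monK t m *: 'X_[m].
Proof.
rewrite /act_poly comp_mpolyX.
under eq_bigr do rewrite tnth_mktuple exprZn.
by rewrite scaler_prod -mpolyXE_id.
Qed.

Lemma act_polyE t g : act_poly t g = \sum_(m <- msupp g) (monK t m * g@_m) *: 'X_[m].
Proof.
rewrite {1}(mpolyE g) /act_poly raddf_sum; apply: eq_bigr => m _.
by rewrite /= comp_mpolyZ -/(act_poly t 'X_[m]) act_polyX scalerA mulrC.
Qed.

Lemma mcoeff_act t g m : (act_poly t g)@_m = monK t m * g@_m.
Proof.
rewrite act_polyE raddf_sum /=; under eq_bigr do rewrite mcoeffZ mcoeffX.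
case: (boolP (m \in msupp g)) => mG; last first.
  rewrite (memN_msupp_eq0 mG) mulr0 big_seq big1 // => i iG.
  by case: eqP => [ei|_]; rewrite ?mulr0 //; move: mG; rewrite -ei iG.
rewrite (bigD1_seq m) //= ?msupp_uniq // eqxx mulr1.
by rewrite big1 ?addr0 // => i /negbTE ->; rewrite mulr0.
Qed.

Lemma act_poly_eq0 t g : torus t -> (act_poly t g == 0) = (g == 0).
Proof.
move=> ht; apply/eqP/eqP => [h|->]; last by rewrite /act_poly raddf0.
apply/mpolyP => m; have /eqP := congr1 (mcoeff m) h.
by rewrite mcoeff_act mcoeff0 mulf_eq0 (negbTE (monK_neq0 _ ht)) => /eqP.
Qed.

Lemma conefunE f : f = tofrac (\n_(repr f)) / tofrac (\d_(repr f)).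
Proof.
have d0 := denom_ratioP (repr f).
rewrite -{1}[f]reprK -{1}(Ratio_numden (repr f)); unlock FracField.tofrac.
rewrite -[X in _ * X]FracField.pi_inv -[RHS]FracField.pi_mul /FracField.invf /FracField.mulf /=.
by rewrite !numden_Ratio ?oner_eq0 ?mul1r ?mulr1.
Qed.

Lemma scalK0 : scalK 0 = 0 :> conefun k.
Proof. by rewrite /scalK mpolyC0 tofrac0. Qed.

Lemma scalK1 : scalK 1 = 1 :> conefun k.
Proof. by rewrite /scalK mpolyC1 tofrac1. Qed.

Variable t : 'I_3 -> k.
Hypothesis ht : torus t.

(** [actK] reads off a chosen representative; cross-multiplication shows that every other fraction
    gives the same value. *)
Lemma actK_frac g h : h != 0 ->
  actK t (tofrac g / tofrac h) = tofrac (act_poly t g) / tofrac (act_poly t h).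
Proof.
move=> h0; set f := _ / _; have := conefunE f.
rewrite /actK; set n := \n_(_); have := denom_ratioP (repr f); set d := \d_(_).
move=> d0 /eqP; rewrite /f eqr_div ?tofrac_eq0 // -!tofracM tofrac_eq => /eqP e.
apply/eqP; rewrite eqr_div ?tofrac_eq0 ?act_poly_eq0 // -!tofracM tofrac_eq.
by rewrite -!rmorphM /= e.
Qed.

Lemma actK_tofrac g : actK t (tofrac g) = tofrac (act_poly t g).
Proof.
rewrite -[tofrac g]divr1 -tofrac1 actK_frac ?oner_eq0 //.
by rewrite /act_poly rmorph1 tofrac1 divr1.
Qed.

Lemma fracP f : exists g (h : {mpoly k[3]}), h != 0 /\ f = tofrac g / tofrac h.
Proof. by exists (\n_(repr f)), (\d_(repr f)); split; [exact: denom_ratioP|exact: conefunE]. Qed.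

Lemma actK_zmod : zmod_morphism (actK t).
Proof.
move=> f1 f2; have [g1 [h1 [n1 ->]]] := fracP f1; have [g2 [h2 [n2 ->]]] := fracP f2.
rewrite -mulNr -tofracN addf_div ?tofrac_eq0 // -!tofracM -tofracD !actK_frac ?mulf_neq0 //.
rewrite -mulNr -tofracN addf_div ?tofrac_eq0 ?act_poly_eq0 // -!tofracM -tofracD.
by rewrite /act_poly !(rmorphD, rmorphM, rmorphN) /=.
Qed.

Lemma actK_monoid : monoid_morphism (actK t).
Proof.
split=> [|f1 f2]; first by rewrite -tofrac1 actK_tofrac /act_poly rmorph1.
have [g1 [h1 [n1 ->]]] := fracP f1; have [g2 [h2 [n2 ->]]] := fracP f2.
rewrite mulf_div -!tofracM !actK_frac ?mulf_neq0 // mulf_div -!tofracM.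
by rewrite /act_poly !rmorphM.
Qed.

HB.instance Definition _ := GRing.isZmodMorphism.Build _ _ (actK t) actK_zmod.
HB.instance Definition _ := GRing.isMonoidMorphism.Build _ _ (actK t) actK_monoid.

Lemma actKM f1 f2 : actK t (f1 * f2) = actK t f1 * actK t f2.
Proof. exact: rmorphM. Qed.

Lemma actKD f1 f2 : actK t (f1 + f2) = actK t f1 + actK t f2.
Proof. exact: rmorphD. Qed.

Lemma actKB f1 f2 : actK t (f1 - f2) = actK t f1 - actK t f2.
Proof. exact: rmorphB. Qed.

Lemma actK0 : actK t 0 = 0.
Proof. exact: rmorph0. Qed.

Lemma actK_sum (I : Type) (r : seq I) (P : pred I) (F : I -> conefun k) :
  actK t (\sum_(i <- r | P i) F i) = \sum_(i <- r | P i) actK t (F i).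
Proof. exact: rmorph_sum. Qed.

Lemma actK_scal c : actK t (scalK c) = scalK c.
Proof. by rewrite /scalK actK_tofrac /act_poly comp_mpolyC. Qed.

Lemma actK_X m : actK t (tofrac 'X_[m]) = scalK (monK t m) * tofrac 'X_[m].
Proof. by rewrite actK_tofrac act_polyX /scalK -tofracM mul_mpolyC. Qed.

Lemma actK_x i : actK t (xK k i) = scalK (t i) * xK k i.
Proof. by rewrite /xK actK_X monK1. Qed.

Lemma scalKV c : (scalK c : conefun k)^-1 = scalK c^-1.
Proof.
have [->|c0] := eqVneq c 0; first by rewrite scalK0 !invr0 scalK0.
have s0 : scalK c != 0 :> conefun k by rewrite tofrac_eq0 mpolyC_eq0.
apply: (mulfI s0); rewrite divff // /scalK -tofracM -mpolyCM divff.
  by rewrite mpolyC1 tofrac1.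
by [].
Qed.

Lemma OO_act e I f : OO e I f -> OO e I (actK t f).
Proof.
move=> /OO_def[g [dg [N [h1 h2 ->]]]].
rewrite fmorph_div /= actK_X actK_tofrac invfM mulrCA scalKV; apply: OO_scalM.
apply/OO_def; exists (act_poly t g), dg, N; split=> //.
rewrite act_polyE big_seq; apply: rpred_sum => m mg; apply: rpredZ.
by rewrite dhomogX; apply/eqP; move/dhomogP: h1; apply.
Qed.
End Torus.

Section Torus2.
Variable k : fieldType.
Implicit Types (t : 'I_3 -> k) (f : conefun k) (g h : {mpoly k[3]}).

Lemma act_polyVK t g : torus t -> act_poly (torusV t) (act_poly t g) = g.
Proof.
move=> ht; apply/mpolyP => m; rewrite !mcoeff_act monKV mulrA mulVf ?mul1r //.
exact: monK_neq0.
Qed.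

Lemma actKVK t f : torus t -> actK (torusV t) (actK t f) = f.
Proof.
move=> ht; have [g [h [n ->]]] := fracP f; have hv := torusVP ht.
by rewrite actK_frac // actK_frac ?act_poly_eq0 // !act_polyVK.
Qed.

(** The row in [actR] satisfies the equation of R, because its sum against the x_j is the image
    under t of the same sum for v; so [vsproj] leaves it unchanged. *)
Lemma actRE t v j : torus t -> vsval (actR t v) 0 j = scalK (t j) * actK t (vsval v 0 j).
Proof.
move=> ht; rewrite /actR vsprojK ?mxE // RKE.
under eq_bigr do rewrite mxE mulrAC -actK_x // -actKM // mulrC.
by rewrite -actK_sum // RK_rel actK0.
Qed.

(** The action on K is only semilinear: the twist by t on values undoes the twist by its inverse on
    arguments. *)
Lemma actRdual_linear t (l : RKdual k) : torus t ->
  linear (fun v : RKtype k => (actK t (l (actR (torusV t) v)) : (conefun k)^o)).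
Proof.
move=> ht c u v; have hv := torusVP ht.
have lin (a : conefun k) (u1 u2 : RKtype k) : l (a *: u1 + u2) = a * (l u1 : conefun k) + l u2.
  exact: (linearP l a u1 u2).
have -> : actR (torusV t) (c *: u + v) =
    actK (torusV t) c *: actR (torusV t) u + actR (torusV t) v.
  apply/val_inj/rowP => j; rewrite /= !mxE !actRE // linearP !mxE actKD // actKM //.
  by rewrite mulrDr mulrCA.
rewrite lin actKD // actKM //; congr (_ * _ + _).
by rewrite -{1}(torusVK t) actKVK.
Qed.

Lemma actRdualE t (l : RKdual k) v : torus t -> actRdual t l v = actK t (l (actR (torusV t) v)).
Proof. by move=> ht; rewrite /actRdual linfunE //; exact: actRdual_linear. Qed.

Lemma actRdual_eps t j : torus t -> actRdual (torusV t) (epsR k j) = scalK (t j) *: epsR k j.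
Proof.
move=> ht; have hv := torusVP ht; apply/lfunP => v.
rewrite actRdualE // torusVK epsRE actRE // scale_lfunE epsRE.
by rewrite actKM // actKVK // actK_scal.
Qed.

Variable d : nat.

Lemma actDR_sym t (phi : formK k d) : torus t ->
  sym_multilinear phi -> sym_multilinear (actDR t phi).
Proof.
move=> ht [lin sym]; have hv := torusVP ht.
split=> [l i a u v|l s].
  have h w : [ffun q => actRdual (torusV t) (upd l i w q)]
      = upd [ffun q => actRdual (torusV t) (l q)] i (actRdual (torusV t) w).
    by apply/ffunP => q; rewrite !ffunE; case: eqP.
  rewrite /actDR !h.
  have -> : actRdual (torusV t) (a *: u + v) =
      actK (torusV t) a *: actRdual (torusV t) u + actRdual (torusV t) v.
    apply/lfunP => w; rewrite add_lfunE scale_lfunE !actRdualE //.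
    by rewrite add_lfunE scale_lfunE actKD // /GRing.scale /= actKM.
  rewrite lin actKD // actKM //; congr (_ * _ + _).
  by rewrite -{1}(torusVK t) actKVK.
rewrite /actDR -[in RHS](sym _ s); congr (actK t (phi _)).
by apply/ffunP => q; rewrite !ffunE.
Qed.

Lemma crd_actDR t (phi : formK k d) a : torus t -> sym_multilinear phi -> mdeg a = d ->
  crd (actDR t phi) a = scalK (monK t a) * actK t (crd phi a).
Proof.
move=> ht sm ad; rewrite {1}/crd /phis /actDR.
have -> : [ffun q => actRdual (torusV t) ([ffun q0 : 'I_d => [seq epsR k j | j <- mons a]`_q0] q)]
    = [ffun q : 'I_d => [seq scalK (t j) *: epsR k j | j <- mons a]`_q].
  apply/ffunP => q; rewrite !ffunE !(nth_map 0) ?size_mons ?ad //.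
  by rewrite actRdual_eps.
rewrite -/(phis phi _) -(actK_scal ht) -actKM //; congr (actK t _).
(* In the induction, s collects the arguments whose scalar has already been pulled out. *)
suff h s M : size (s ++ M) = d ->
    phis phi ([seq scalK (t j) *: epsR k j | j <- M] ++ [seq epsR k j | j <- s])
    = scalK (\prod_(j <- M) t j) * phis phi [seq epsR k j | j <- s ++ M].
  have := h [::] (mons a); rewrite cats0 => -> //; last by rewrite size_mons.
  congr (scalK _ * _); rewrite -{2}(cntm_mons a).
  elim: (mons a) => [|j M IH].
    by rewrite big_nil /monK big1 // => i _; rewrite mnmE expr0.
  by rewrite big_cons IH cntm_cons monKD monK1.
elim: M s => [|j M IH] s sd.
  by rewrite big_nil cats0 /scalK mpolyC1 tofrac1 mul1r.
have sz : (size ([seq scalK (t j) *: epsR k j | j <- M] ++ [seq epsR k j | j <- s])).+1 = d.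
  by rewrite size_cat !size_map -sd size_cat /= addnC addnS.
have := phis_sum (fun i => if i == j then scalK (t j) else 0) (fun i => epsR k i) sm sz.
rewrite (bigD1 j) //= eqxx big1 ?addr0; last by move=> i /negbTE ->; rewrite scale0r.
rewrite (bigD1 j) //= eqxx big1 ?addr0; last by move=> i /negbTE ->; rewrite mul0r.
move=> ->; rewrite big_cons.
have -> : scalK (t j * \prod_(j0 <- M) t j0)
    = scalK (t j) * scalK (\prod_(j0 <- M) t j0) :> conefun k.
  by rewrite /scalK mpolyCM tofracM.
rewrite -mulrA; congr (_ * _).
have sd' : size ((j :: s) ++ M) = d by rewrite -sd !size_cat /= addnS.
transitivity (scalK (\prod_(j0 <- M) t j0) * phis phi [seq epsR k j0 | j0 <- (j :: s) ++ M]).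
  rewrite -IH //; apply: phis_perm => //.
  exact: permEl (perm_catCA [:: epsR k j] _ _).
congr (_ * _); apply: phis_perm => //; first by rewrite size_map.
by apply: perm_map; rewrite /= perm_sym; exact: permEl (perm_catCA s [:: j] M).
Qed.

(** Regularity is read off the coordinates, so the action on sections of the dual of R need not be
    examined. *)
Lemma secDR_act e (I : {set 'I_3}) i t (phi : formK k d) : torus t -> i \in I ->
  secDR e I phi -> secDR e I (actDR t phi).
Proof.
move=> ht iI sphi; have sa := actDR_sym ht sphi.1.
have -> : actDR t phi = symform i (crd (actDR t phi)).
  by apply: functional_extensionality => L; rewrite symform_crd.
apply: symform_sec => // a ad; rewrite crd_actDR //; last exact: sphi.1.
by apply: OO_scalM; apply: OO_act => //; exact: crd_OO.
Qed.
End Torus2.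

(** * The cokernel presentation of H^1 *)

Lemma fun_choice (A B : Type) (b0 : B) (P : A -> B -> Prop) :
  (forall a, exists b, P a b) -> exists f : A -> B, forall a, P a (f a).
Proof.
move=> h; exists (fun a => epsilon (inhabits b0) (P a)) => a.
exact: epsilon_spec (h a).
Qed.

Lemma mcoeff_XUM (k : fieldType) (i : 'I_3) (G : {mpoly k[3]}) b :
  ('X_i * G)@_b = if (0 < b i)%N then G@_(b - U_(i)) else 0.
Proof.
rewrite mulrC; case: ifP => h.
  have e : b = (U_(i) + (b - U_(i)))%MM.
    by rewrite addmC submK // lep1mP -lt0n.
  by rewrite {1}e mcoeffMX.
apply/eqP; rewrite mcoeff_eq0; apply/negP => /msuppMXP[m _ e].
by move: h; rewrite e mnmDE mnm1E eqxx.
Qed.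

Section SymLin.
Variables (k : fieldType) (d : nat).
Implicit Types phi psi : formK k d.

Lemma sym_multilinear_comb (c : conefun k) phi psi : sym_multilinear phi -> sym_multilinear psi ->
  sym_multilinear (fun l => c * phi l + psi l).
Proof.
move=> [l1 s1] [l2 s2]; split=> [l i a u v|l s]; last by rewrite s1 s2.
by rewrite l1 l2 !mulrDr mulrCA addrACA.
Qed.

Lemma sym_multilinear0 : sym_multilinear (fun _ : {ffun 'I_d -> RKdual k} => 0).
Proof. by split=> // *; rewrite mulr0 addr0. Qed.

Lemma sym_multilinearB phi psi : sym_multilinear phi -> sym_multilinear psi ->
  sym_multilinear (fun l => phi l - psi l).
Proof.
move=> h1 h2; have := sym_multilinear_comb (-1) h2 h1.
have -> // : (fun l => -1 * psi l + phi l) = (fun l => phi l - psi l).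
by apply: functional_extensionality => l; rewrite mulN1r addrC.
Qed.

Lemma secDR_comb e (I : {set 'I_3}) (c : k) phi psi : secDR e I phi -> secDR e I psi ->
  secDR e I (fun l => scalK c * phi l + psi l).
Proof.
move=> [s1 h1] [s2 h2]; split; first exact: sym_multilinear_comb.
by move=> l hl; apply: OO_add; [apply/OO_scalM/h1|apply: h2].
Qed.
End SymLin.

Section Rep.
Variables (k : fieldType) (d e : nat).
Implicit Types (z : cochain1 k d) (g : 'X_{1..3} -> {mpoly k[3]}).

Definition homg g := forall a, (mdeg a).+1 = d -> g a \is e.-homog.

(* g in D^(d-1) V (x) Sym^e V represents the class of z under the connecting
   homomorphism H^0(D^(d-1) V (x) O(e)) -> H^1(D^d R(e - 1)). *)
Definition Rep z g := cocycle1 (e%:Z - 1) z /\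
  exists c : 'I_3 -> 'X_{1..3} -> conefun k,
  [/\ forall i a, mdeg a = d -> OO (e%:Z - 1) [set i] (c i a),
      forall i j a, mdeg a = d -> crd (z i j) a = c j a - c i a
    & forall i a, (mdeg a).+1 = d -> \sum_m xK k m * c i (a + U_(m))%MM = tofrac (g a)].

Lemma set1n0 (i : 'I_3) : [set i] != set0.
Proof. by apply/set0Pn; exists i; rewrite set11. Qed.

Lemma mdegU (a : 'X_{1..3}) m : mdeg (a + U_(m))%MM = (mdeg a).+1.
Proof. by rewrite mdegD mdeg1 addn1. Qed.

Lemma mdegBU (a : 'X_{1..3}) m : (0 < a m)%N -> (mdeg (a - U_(m))%MM).+1 = mdeg a.
Proof. by move=> h; rewrite -(mdegU _ m) submK // lep1mP -lt0n. Qed.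

(** Each coordinate of z splits separately, as H^1(P, O(e - 1)) = 0. The resulting c_i may violate
    [rel0], but their defect S i a is independent of i because z i j has none; it is therefore a
    global section of O(e). *)
Lemma Rep_exists z : cocycle1 (e%:Z - 1) z -> exists2 g, homg g & Rep z g.
Proof.
move=> cz; have [zO zC] := cz.
have zS i j : sym_multilinear (z i j) := (zO i j).1.
have [c hc] : exists c : 'X_{1..3} -> 'I_3 -> conefun k, forall a, mdeg a = d ->
   (forall i, OO (e%:Z - 1) [set i] (c a i)) /\ (forall i j, crd (z i j) a = c a j - c a i).
  refine (@fun_choice 'X_{1..3} ('I_3 -> conefun k) (fun=> 0) (fun a c => mdeg a = d ->
    (forall i, OO (e%:Z - 1) [set i] (c i)) /\ (forall i j, crd (z i j) a = c j - c i)) _) => a.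
  have [ad|ad] := eqVneq (mdeg a) d; last by exists (fun=> 0) => /eqP; rewrite (negbTE ad).
  have [c hc] : exists c : 'I_3 -> conefun k, (forall i, OO (e%:Z - 1) [set i] (c i)) /\
      (forall i j, crd (z i j) a = c j - c i).
    apply: cech1_OO => [i j|i j m]; first exact: crd_OO (zO i j).
    exact: zC.
  by exists c.
pose S i a := \sum_m xK k m * c (a + U_(m))%MM i.
have SO i a : (mdeg a).+1 = d -> OO e [set i] (S i a).
  move=> ad; apply: OO_sum; first exact: set1n0.
  move=> m _; rewrite (_ : e%:Z = 1 + (e%:Z - 1)); last by lia.
  apply: OO_mul; first exact: OO_x.
  by apply: (hc _ _).1; rewrite mdegU.
have Sij i j a : (mdeg a).+1 = d -> S i a = S j a.
  move=> ad; apply/eqP; rewrite eq_sym -subr_eq0 -sumrB; apply/eqP.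
  rewrite -[RHS](crd_rel0 (zS i j) ad); apply: eq_bigr => m _.
  by rewrite -mulrBr (hc _ _).2 ?mdegU.
have [g hg] : exists g : 'X_{1..3} -> {mpoly k[3]}, forall a, (mdeg a).+1 = d ->
    S 0 a = tofrac (g a) /\ forall m, m \in msupp (g a) -> (mdeg m)%:Z = e%:Z.
  refine (@fun_choice 'X_{1..3} {mpoly k[3]} 0 (fun a G => (mdeg a).+1 = d ->
    S 0 a = tofrac G /\ forall m, m \in msupp G -> (mdeg m)%:Z = e%:Z) _) => a.
  have [ad|ad] := eqVneq (mdeg a).+1 d; last by exists 0 => /eqP; rewrite (negbTE ad).
  have [|G eG hG] := @OO_global k e%:Z (S 0 a); last by exists G.
  by move=> i; rewrite (Sij 0 i) //; apply: SO.
exists g; first by move=> a ad; apply/dhomogP => m /((hg _ ad).2 m)[].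
split=> //; exists (fun i a => c a i); split=> [i a ad|i j a ad|i a ad].
- exact: (hc _ ad).1.
- exact: (hc _ ad).2.
by rewrite -/(S i a) (Sij i 0) // (hg _ ad).1.
Qed.

(* A local section of D^d V (x) O(e - 1) -> D^(d-1) V (x) O(e) over D+(x_i), by
   recursion on the exponent n = a_i. *)
Fixpoint liftc (g : 'X_{1..3} -> {mpoly k[3]}) (i : 'I_3) (n : nat) (a : 'X_{1..3}) : conefun k :=
  if n is n'.+1 then
    (tofrac (g (a - U_(i))%MM)
      - \sum_(m | m != i) xK k m * liftc g i n' (a - U_(i) + U_(m))%MM) / xK k i
  else 0.

Lemma liftc_OO g i n a : homg g -> mdeg a = d -> n = a i -> OO (e%:Z - 1) [set i] (liftc g i n a).
Proof.
move=> hg; elim: n a => [|n IH] a ad an /=; first by apply: OO0; exact: set1n0.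
have dU : (mdeg (a - U_(i))).+1 = d.
  by rewrite mdegBU // -an.
apply: OO_mul; last by apply: OO_xV; rewrite set11.
apply: OO_sub; first by apply: OO_X; exact: hg.
apply: OO_sum; first exact: set1n0.
move=> m mi; rewrite (_ : e%:Z = 1 + (e%:Z - 1)); last by lia.
apply: OO_mul; first exact: OO_x.
apply: IH; first by rewrite mdegU.
by rewrite mnmDE mnmBE !mnm1E eqxx (negbTE mi) -an; lia.
Qed.

Lemma liftc_rel g i a :
  \sum_m xK k m * liftc g i ((a + U_(m))%MM i) (a + U_(m))%MM = tofrac (g a).
Proof.
rewrite (bigD1 i) //= {1}mnmDE mnm1E eqxx addn1 /=.
rewrite addmK mulrC divfK ?xK_neq0 //.
rewrite [X in _ + X](_ : _ = \sum_(m | m != i) xK k m * liftc g i (a i) (a + U_(m))%MM).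
  by rewrite subrK.
by apply: eq_bigr => m /negbTE mi; rewrite mnmDE mnm1E mi addn0.
Qed.

(** Two local lifts of g differ by a solution of [rel0], that is, by a section of D^d R. *)
Lemma Rep_surj g : homg g -> exists z, Rep z g.
Proof.
move=> hg; pose c i (a : 'X_{1..3}) := liftc g i (a i) a.
have cO i a : mdeg a = d -> OO (e%:Z - 1) [set i] (c i a) by move=> ad; apply: liftc_OO.
pose z i j := symform (d := d) i (fun a => c j a - c i a).
have r0 i j : rel0 d (fun a => c j a - c i a).
  move=> a ad; under eq_bigr do rewrite mulrBr.
  by rewrite sumrB !liftc_rel subrr.
have zc i j a : mdeg a = d -> crd (z i j) a = c j a - c i a.
  by move=> ad; rewrite crd_symform.
have zs i j : sym_multilinear (z i j) by exact: symform_sym.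
exists z; split; last first.
  by exists c; split=> // i a ad; exact: liftc_rel.
split=> [i j|i j m].
  apply: symform_sec => [|a ad]; first by rewrite set21.
  by apply: OO_sub; [apply: OO_mono (cO j a ad)|apply: OO_mono (cO i a ad)];
    rewrite sub1set ?set21 ?set22.
have s1 := sym_multilinear_comb 1 (sym_multilinearB (zs j m) (zs i m)) (zs i j).
move=> l; have := crd_inj s1 (@sym_multilinear0 k d) _ l; rewrite mul1r; apply=> a ad.
rewrite [RHS](_ : _ = 0) // [LHS](_ : _ = 1 * (crd (z j m) a - crd (z i m) a) + crd (z i j) a) //.
by rewrite !zc //; ring.
Qed.

Lemma Rep_comb z z' g g' (al : k) : Rep z g -> Rep z' g' ->
  Rep (fun i j l => scalK al * z i j l + z' i j l) (fun a => al *: g a + g' a).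
Proof.
move=> [[zO zC] [c [c1 c2 c3]]] [[zO' zC'] [c' [c1' c2' c3']]]; split.
  split=> [i j|i j m l]; first exact: secDR_comb.
  have := zC i j m l; have := zC' i j m l => h' h.
  transitivity (scalK al * (z j m l - z i m l + z i j l) + (z' j m l - z' i m l + z' i j l)).
    by ring.
  by rewrite h h' mulr0 addr0.
exists (fun i a => scalK al * c i a + c' i a); split=> [i a ad|i j a ad|i a ad].
- by apply: OO_add; [apply/OO_scalM/c1|apply: c1'].
- rewrite [LHS](_ : _ = scalK al * crd (z i j) a + crd (z' i j) a) //.
  by rewrite c2 // c2' // mulrBr opprD addrACA.
under eq_bigr do rewrite mulrDr mulrCA.
by rewrite big_split -mulr_sumr /= c3 // c3' // tofracD -mul_mpolyC tofracM.
Qed.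

(* g lies in the image of D^d V (x) Sym^(e-1) V; H a b is the coefficient of
   x^(a) (x) x^b, and the shifts b - U_(i) make the case e = 0 uniform. *)
Definition delta_exact g := exists H : 'X_{1..3} -> 'X_{1..3} -> k, forall a b,
  (mdeg a).+1 = d -> mdeg b = e ->
  (g a)@_b = \sum_(i | (0 < b i)%N) H (a + U_(i))%MM (b - U_(i))%MM.

Lemma mcoeff_delta (h : 'X_{1..3} -> {mpoly k[3]}) a b :
  (\sum_i 'X_i * h (a + U_(i))%MM)@_b
    = \sum_(i | (0 < b i)%N) (h (a + U_(i))%MM)@_(b - U_(i)).
Proof.
rewrite raddf_sum [RHS]big_mkcond /=; apply: eq_bigr => i _.
by rewrite mcoeff_XUM.
Qed.

(** If z is the coboundary of C, the c_i minus the coordinates of C_i glue to a global lift of g.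
    Conversely, subtracting a global lift from the c_i leaves sections of D^d R with coboundary
    z. *)
Lemma Rep_coboundary z g : homg g -> Rep z g -> coboundary1 (e%:Z - 1) z <-> delta_exact g.
Proof.
move=> hg [[zO zC] [c [c1 c2 c3]]]; split=> [[C [CO zE]]|[H hH]].
  have CS i : sym_multilinear (C i) := (CO i).1.
  pose h i a := c i a - crd (C i) a.
  have hij i j a : mdeg a = d -> h i a = h j a.
    move=> ad; apply/eqP; rewrite eq_sym -subr_eq0 /h.
    have := c2 i j a ad; rewrite [crd _ _](_ : _ = crd (C j) a - crd (C i) a); last exact: zE.
    move=> e2; rewrite (_ : _ - _ = (c j a - c i a) - (crd (C j) a - crd (C i) a)).
      by rewrite e2 subrr.
    by ring.
  have [G hG] : exists G : 'X_{1..3} -> {mpoly k[3]}, forall a, mdeg a = d -> h 0 a = tofrac (G a).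
    refine (@fun_choice 'X_{1..3} {mpoly k[3]} 0
      (fun a G => mdeg a = d -> h 0 a = tofrac G) _) => a.
    have [ad|ad] := eqVneq (mdeg a) d; last by exists 0 => /eqP; rewrite (negbTE ad).
    have [|G eG _] := @OO_global k (e%:Z - 1) (h 0 a); last by exists G.
    move=> i; rewrite (hij 0 i) //; apply: OO_sub; first exact: c1.
    exact: crd_OO (CO i).
  exists (fun a b => (G a)@_b) => a b ad bd.
  rewrite -mcoeff_delta; congr (_@__); apply/eqP; rewrite -tofrac_eq; apply/eqP.
  rewrite -(c3 0 a ad) rmorph_sum /=.
  rewrite -[LHS]subr0 -[X in _ - X](crd_rel0 (CS 0) ad) -sumrB; apply: eq_bigr => m _.
  by rewrite tofracM -hG ?mdegU // mulrBr.
(* For e = 0 the sum is empty, in accordance with H^0(P, O(-1)) = 0. *)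
pose hp a : {mpoly k[3]} := \sum_(b : 'X_{1..3 < e} | (mdeg b).+1 == e) H a b *: 'X_[b].
have hpE a b : (mdeg b).+1 = e -> (hp a)@_b = H a b.
  move=> be; have be' : (mdeg b < e)%N by rewrite -be.
  rewrite /hp raddf_sum (bigD1 (BMultinom be')) /= ?be //.
  rewrite mcoeffZ mcoeffX eqxx mulr1 big1 ?addr0 // => b' /andP[_ nb].
  rewrite mcoeffZ mcoeffX; case: eqP => [eb|_]; last by rewrite mulr0.
  by case/eqP: nb; apply: val_inj.
have hpO i a : OO (e%:Z - 1) [set i] (tofrac (hp a)).
  case: (posnP e) => e0.
    rewrite /hp big1 ?tofrac0; first by apply: OO0; exact: set1n0.
    by move=> b; rewrite {2}e0.
  rewrite (_ : e%:Z - 1 = e.-1%:Z); last by lia.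
  apply: OO_X; apply: rpred_sum => b /eqP be; apply: rpredZ; rewrite dhomogX /=.
  by apply/eqP; rewrite -[in RHS]be.
have hpd a : (mdeg a).+1 = d -> \sum_i 'X_i * hp (a + U_(i))%MM = g a.
  move=> ad; apply/mpolyP => b; rewrite mcoeff_delta.
  have [be|be] := eqVneq (mdeg b) e.
    rewrite hH //; apply: eq_bigr => i bi; rewrite hpE //.
    by rewrite mdegBU.
  rewrite (dhomog_nemf_coeff (hg a ad)) // big1 // => i bi.
  rewrite /hp raddf_sum big1 //= => b' /eqP be'; rewrite mcoeffZ mcoeffX.
  case: eqP => [eb|_]; last by rewrite mulr0.
  by case/eqP: be; rewrite -be' eb mdegBU.
pose f i a := c i a - tofrac (hp a).
have fr i : rel0 d (f i).
  move=> a ad; rewrite /f; under eq_bigr do rewrite mulrBr.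
  by rewrite sumrB c3 // -hpd // rmorph_sum /= (eq_bigr _ (fun m _ => tofracM _ _)) subrr.
exists (fun i => symform i (f i)); split=> [i|i j l].
  apply: symform_sec => [|a ad]; first by rewrite set11.
  by apply: OO_sub => //; apply: c1.
have s1 := sym_multilinearB (symform_sym d j (f j)) (symform_sym d i (f i)).
apply: (crd_inj (zO i j).1 s1) => a ad.
rewrite [RHS](_ : _ = crd (symform (d := d) j (f j)) a - crd (symform (d := d) i (f i)) a) //.
by rewrite !crd_symform // c2 // /f opprB addrA subrK.
Qed.

Lemma Rep_act z g t : torus t -> Rep z g ->
  Rep (fun i j => actDR t (z i j)) (fun a => monK t a *: act_poly t (g a)).
Proof.
move=> ht [[zO zC] [c [c1 c2 c3]]]; split.
  split=> [i j|i j m l]; first by apply: (@secDR_act _ _ _ _ i) => //; rewrite set21.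
  by rewrite -actKB // -actKD // zC actK0.
exists (fun i a => scalK (monK t a) * actK t (c i a)); split=> [i a ad|i j a ad|i a ad].
- by apply: OO_scalM; apply: OO_act => //; exact: c1.
- by rewrite crd_actDR //; [rewrite c2 // actKB // mulrBr|exact: (zO i j).1].
have sM x y : scalK (x * y) = scalK x * scalK y :> conefun k.
  by rewrite /scalK mpolyCM tofracM.
rewrite -mul_mpolyC tofracM -actK_tofrac // -(c3 i a ad) actK_sum // mulr_sumr.
apply: eq_bigr => m _; rewrite actKM // actK_x // monKD monK1 sM.
by rewrite mulrCA -!mulrA; congr (_ * _); rewrite mulrCA.
Qed.
End Rep.

(** * Runs of zeros in the Pascal triangle *)

Lemma coef_X1n (k : fieldType) n m : (('X + 1) ^+ n : {poly k})`_m = 'C(n, m)%:R.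
Proof.
rewrite exprD1n coef_sum; have [h|h] := ltnP m n.+1.
  rewrite (bigD1 (Ordinal h)) //= coefMn coefXn eqxx big1 ?addr0 // => i /eqP ni.
  rewrite coefMn coefXn; case: eqP => [e|_]; last by rewrite mul0rn.
  by case: ni; apply: val_inj.
rewrite bin_small // big1 // => i _; rewrite coefMn coefXn.
by case: eqP => [e|_]; [move: h (ltn_ord i); rewrite e; lia | rewrite mul0rn].
Qed.

Section Binomials.
Variables (k : fieldType) (p : nat).
Hypothesis charp : p \in [pchar k].

(* The digits 0 .. r - 1 and the remaining ones, in (1 + X)^(p^r) = 1 + X^(p^r). *)
Lemma lucas r D delta K x : (delta < p ^ r)%N -> (x < p ^ r)%N ->
  ('C(D * p ^ r + delta, K * p ^ r + x))%:R = 'C(D, K)%:R * 'C(delta, x)%:R :> k.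
Proof.
have pp := pcharf_prime charp.
set q := (p ^ r)%N => hd hx.
have charP : p \in [pchar {poly k}] by rewrite pchar_poly.
have frob : ('X + 1) ^+ q = 'X^q + 1 :> {poly k}.
  rewrite exprDn_pchar ?expr1n // /q pnatX.
  by rewrite pnatE // charP.
rewrite -coef_X1n exprD [(D * q)%N]mulnC exprM frob exprD1n mulr_suml coef_sum.
have term i : ('X^q ^+ i *+ 'C(D, i) * ('X + 1) ^+ delta : {poly k})`_(K * q + x)
    = if i == K then 'C(D, K)%:R * 'C(delta, x)%:R else 0.
  rewrite [(K * q)%N]mulnC mulrnAl coefMn -exprM coefXnM coef_X1n.
  case: eqP => [->|/eqP ni].
    by rewrite ltnNge leq_addr /= addKn -[LHS]mulr_natl.
  case: ltnP => h; first by rewrite mul0rn.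
  have iK : (i < K)%N.
    rewrite ltn_neqAle ni leqNgt; apply/negP => Ki.
    by have := leq_mul (leqnn q) Ki; rewrite mulnS; lia.
  rewrite bin_small ?mul0rn //.
  by have := leq_mul (leqnn q) iK; rewrite mulnS; lia.
under eq_bigr do rewrite term.
have [h|h] := ltnP K D.+1.
  rewrite (bigD1 (Ordinal h)) //= eqxx big1 ?addr0 // => i /eqP ni.
  by case: eqP => // e; case: ni; apply: val_inj.
rewrite [in RHS]bin_small // mul0r big1 // => i _.
by case: eqP => // e; move: (ltn_ord i) h; rewrite e; lia.
Qed.

(** The binomial divides n!, which is prime to p for n < p. *)
Lemma bin_neq0 n m : (n < p)%N -> (m <= n)%N -> 'C(n, m)%:R != 0 :> k.
Proof.
move=> np mn; rewrite -(dvdn_pcharf charp).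
have pp := pcharf_prime charp; apply/negP => pd.
have : (p %| n`!)%N by rewrite -(bin_fact mn) dvdn_mulr.
elim: n np {mn pd} => [|n IH] np; first by rewrite fact0 dvdn1; case: eqP pp => // ->.
rewrite factS Euclid_dvdM // => /orP[|]; last by apply: IH; lia.
by rewrite gtnNdvd.
Qed.

(* r is chosen maximal with d mod p^r < c - g.  A run of zeros cannot meet the
   positions K p^r and K p^r + (d mod p^r), so it either lies in a gap after
   some K p^r + (d mod p^r), or its translate by - K p^r is a run of zeros too. *)
Lemma zero_run c d g : (forall m, (m <= c)%N -> (c <= m + g)%N -> 'C(d, m)%:R = 0 :> k) ->
  (g < c)%N -> (c < d)%N ->
  exists r, [/\ (d %% p ^ r + g + 2 <= p ^ r)%N, (0 < d %/ p ^ r)%N,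
    ~~ (p %| d %/ p ^ r)%N & (d %% p ^ r + g + 1 <= c)%N].
Proof.
have pp := pcharf_prime charp; have p1 := prime_gt1 pp.
elim/ltn_ind: c => c IH hz gc cd.
pose P r := (d %% p ^ r < c - g)%N.
have P0 : exists r, P r by exists 0%N; rewrite /P expn0 modn1 subn_gt0.
have Pb r : P r -> (r <= d)%N.
  rewrite /P => h; rewrite leqNgt; apply/negP => dr.
  have dpr : (d < p ^ r)%N by apply: (ltn_trans dr); exact: ltn_expl.
  by move: h; rewrite modn_small //; lia.
have [r Pr maxr] := ex_maxnP P0 Pb.
have nP : (c - g <= d %% p ^ r.+1)%N.
  by rewrite leqNgt; apply/negP => /maxr; rewrite ltnn.
have q0 : (0 < p ^ r)%N by rewrite expn_gt0 prime_gt0.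
set q := (p ^ r)%N in q0 *; set D := (d %/ q)%N; set delta := (d %% q)%N.
have ed : d = (D * q + delta)%N by exact: divn_eq.
have dq : (delta < q)%N by rewrite ltn_mod.
have dp : (D %% p < p)%N by rewrite ltn_mod prime_gt0.
have emod : (d %% p ^ r.+1 = D %% p * q + delta)%N.
  rewrite {1}ed {1}(divn_eq D p) mulnDl -mulnA -addnA -expnS modnMDl modn_small //.
  by rewrite expnS -/q; have := leq_mul dp (leqnn q); rewrite mulSn; lia.
rewrite emod in nP; have hdc : (delta < c - g)%N := Pr.
have binD K : (K <= D %% p)%N -> 'C(D, K)%:R != 0 :> k.
  move=> hK; have := @lucas 1 (D %/ p) (D %% p) 0 K; rewrite expn1 -divn_eq mul0n add0n.
  move=> -> //; last exact: leq_ltn_trans hK dp.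
  by rewrite bin0 mul1r; apply: bin_neq0.
(* K is the least integer with c - g <= K q + delta. Maximality of r bounds it by the last base-p
   digit of D, so C(D, K) is nonzero in k. *)
pose X := (c - g - delta - 1)%N; pose K := (X %/ q).+1.
have eX := divn_eq X q; have hX : (X %% q < q)%N by rewrite ltn_mod.
have eK : (K * q = X %/ q * q + q)%N by rewrite mulSn addnC.
have KD : (K <= D %% p)%N.
  by rewrite /K ltn_divLR //; rewrite /X; lia.
have c1 : (c - g <= K * q + delta)%N by rewrite eK; rewrite /X in eX hX *; lia.
have c2 : (K * q + delta < c - g + q)%N by rewrite eK; rewrite /X in eX hX *; lia.
have Kp : (0 < K)%N by [].
have Kq0 : (0 < K * q)%N by rewrite muln_gt0.
move: (K * q)%N (fun x => @lucas r D delta K x dq) c1 c2 Kq0 {eK} => Kq.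
rewrite -/q -ed => luc c1 c2 Kq0.
have n1 : (c < Kq + delta)%N.
  rewrite ltnNge; apply/negP => h; have := luc delta dq; rewrite binn mulr1 hz //; last by lia.
  by move/eqP; rewrite eq_sym (negbTE (binD K KD)).
(* If c < K q, the run lies strictly between (K - 1) q + delta and K q; otherwise it lies strictly
   between K q and K q + delta. *)
have [hcK|Kqc] := ltnP c Kq.
  have D0 : (0 < D %% p)%N by exact: leq_trans Kp KD.
  exists r; split; rewrite -/q -/D -/delta; first by lia.
  - by case: (posnP D) D0 => // ->; rewrite mod0n.
  - by rewrite /dvdn -lt0n.
  by lia.
have Kq2 : (Kq < c - g)%N.
  rewrite ltnNge; apply/negP => h; have := luc 0%N q0; rewrite bin0 mulr1 addn0 hz //; last by lia.
  by move/eqP; rewrite eq_sym (negbTE (binD K KD)).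
have [||||r2 [h1 h2 h3 h4]] := IH (c - Kq)%N.
- by lia.
- move=> m m1 m2; have mq : (m < q)%N by lia.
  have := luc m mq; rewrite hz; try lia.
  move/esym/eqP; rewrite mulf_eq0 (negbTE (binD K KD)) => /eqP h.
  by have := @lucas r D delta 0 m dq mq; rewrite mul0n add0n -/q -ed h mulr0.
- by lia.
- by lia.
by exists r2; split=> //; lia.
Qed.
End Binomials.

(** * Hasse derivatives and windows of vanishing coefficients *)

Section Hasse.
Variable k : fieldType.
Implicit Types P Q : {poly k}.

Lemma nderivn_mul n P Q : (P * Q)^`N(n) = \sum_(i < n.+1) P^`N(i) * Q^`N(n - i).
Proof.
have mulX (R : {poly k}) m : ('X * R)^`N(m.+1) = R^`N(m) + R^`N(m.+1) * 'X.
  by rewrite ['X * R]mulrC -[R * 'X]addr0 -polyC0 nderivnMXaddC.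
elim/poly_ind: P n => [|P c IH] n.
  by rewrite mul0r raddf0 big1 // => i _; rewrite raddf0 mul0r.
case: n => [|n]; first by rewrite big_ord1 !nderivn0.
have -> : (P * 'X + c%:P) * Q = 'X * (P * Q) + c *: Q by rewrite -mul_polyC; ring.
rewrite nderivnD mulX !IH nderivnZ [RHS]big_ord_recl [in X in _ + X * _]big_ord_recl.
rewrite !nderivn0 !subn0 -mul_polyC.
under [X in _ = _ + X]eq_bigr => i _ do
  rewrite lift0 subSS nderivnMXaddC mulrDl.
rewrite big_split /=.
rewrite (_ : \sum_(i < n.+1) P^`N(bump 0 i) * _ = \sum_(i < n.+1) P^`N(i.+1) * Q^`N(n - i)) //.
rewrite (_ : \sum_(i < n.+1) P^`N(i.+1) * 'X * _ =
  (\sum_(i < n.+1) P^`N(i.+1) * Q^`N(n - i)) * 'X); first by ring.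
by rewrite mulr_suml; apply: eq_bigr => i _; rewrite mulrAC.
Qed.

Lemma nderivn_X1n n s : (('X + 1) ^+ n)^`N(s) = ('X + 1) ^+ (n - s) *+ 'C(n, s) :> {poly k}.
Proof.
elim: n s => [|n IH] [|s].
- by rewrite nderivn0.
- by rewrite expr0 -[1]/(1%:P) nderivnC /= bin0n mulr0n.
- by rewrite nderivn0 subn0 bin0 mulr1n.
rewrite exprSr mulrDr mulr1 nderivnD.
have -> : (('X + 1) ^+ n * 'X : {poly k})^`N(s.+1)
    = (('X + 1) ^+ n)^`N(s) + (('X + 1) ^+ n)^`N(s.+1) * 'X.
  by have := nderivnMXaddC s (('X + 1) ^+ n : {poly k}) 0; rewrite polyC0 addr0.
rewrite !IH subSS binS mulrnDr -addrA addrC; congr (_ + _).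
have [sn|ns] := ltnP s n; last by rewrite !bin_small ?mulr0n ?mul0r ?addr0 // ltnS.
transitivity (('X + 1) ^+ (n - s.+1) *+ 'C(n, s.+1) * ('X + 1) : {poly k}).
  by rewrite mulrDr mulr1.
by rewrite mulrnAl -exprSr; congr (_ ^+ _ *+ _); lia.
Qed.

(* By Leibniz' rule, (1 + X)^(n + i) N^`N(i) is a combination of the
   (1 + X)^i' ((1 + X)^n N)^`N(i') with i' <= i; for i = deg N it is a multiple
   of (1 + X)^(n + deg N). *)
Lemma window_lead (N : {poly k}) n v A B :
  (forall m, (m <= v)%N -> (A <= m + B)%N -> (('X + 1) ^+ n * N)`_m = 0) -> N != 0 ->
  forall m, (m + (size N).-1 <= v)%N -> (A <= m + B)%N -> 'C(n + (size N).-1, m)%:R = 0 :> k.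
Proof.
move=> hP nN m hm hA.
have hQ al : forall m, (m + al <= v)%N -> (A <= m + B)%N ->
    (('X + 1) ^+ (n + al) * N^`N(al))`_m = 0.
  elim/ltn_ind: al => al IH {hm hA} m hm hA.
  have e : ('X + 1) ^+ al * (('X + 1) ^+ n * N)^`N(al) =
      ('X + 1) ^+ (n + al) * N^`N(al) +
      \sum_(i < al) ('X + 1) ^+ (n + i) * N^`N(i) *+ 'C(n, al - i).
    rewrite [_ ^+ n * N]mulrC nderivn_mul big_ord_recr /= subnn nderivn0 mulrDr addrC.
    congr (_ + _); first by rewrite exprD; ring.
    rewrite mulr_sumr; apply: eq_bigr => i _; rewrite nderivn_X1n.
    have [h|h] := leqP (al - i) n; last by rewrite bin_small // !mulr0n !mulr0.
    have -> : (n + i = al + (n - (al - i)))%N by have := ltn_ord i; lia.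
    by rewrite exprD -!mulrnAr; ring.
  have := congr1 (fun P : {poly k} => P`_m) e; rewrite /= coefD coef_sum.
  rewrite [X in _ = _ + X]big1 ?addr0 => [<-|i _]; last first.
    by rewrite coefMn IH ?mul0rn //; have := ltn_ord i; lia.
  (* Only the coefficients of (1 + X)^n N at m + al - i with i <= al contribute, and these positions
     stay in the window. *)
  rewrite coefM big1 // => i _; rewrite coef_X1n coef_nderivn.
  have [h|h] := leqP i al; last by rewrite bin_small // mul0r.
  by rewrite hP ?mul0rn ?mulr0 //; have := ltn_ord i; lia.
(* No factorial appears, so this constant is nonzero in every characteristic. *)
have eN : N^`N((size N).-1) = (lead_coef N)%:P.
  apply/polyP => -[|i]; rewrite coef_nderivn coefC /=; first by rewrite addn0 binn.
  by rewrite nth_default ?mul0rn //; lia.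
have := hQ _ m hm hA; rewrite eN coefMC coef_X1n => /eqP.
by rewrite mulf_eq0 lead_coef_eq0 (negbTE nN) orbF => /eqP.
Qed.
End Hasse.

(** * From a functional on one graded piece of the cokernel to a run of zeros *)

Section WeightSpaces.
Variable k : fieldType.
Variables (d e u1 u2 u3 : nat) (f : nat -> nat -> nat -> k).
Hypothesis total : (u1 + u2 + u3 + 1 = d + e)%N.
Hypothesis f_supp : forall b1 b2 b3, f b1 b2 b3 != 0 ->
  [/\ (b1 <= u1)%N, (b2 <= u2)%N & (b3 <= u3)%N].
Hypothesis f_rel : forall b1 b2 b3, (b1 <= u1)%N -> (b2 <= u2)%N -> (b3 <= u3)%N ->
  (b1 + b2 + b3 + 1 = e)%N -> f b1.+1 b2 b3 + f b1 b2.+1 b3 + f b1 b2 b3.+1 = 0.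

(** The exponent is u3 - b3, so that raising b3 becomes multiplication by X; the guard rejects
    truncated values of e - b3. *)
Let N : {poly k} :=
  \poly_(t < u3.+1) (if (u3 - t <= e)%N then f 0 (e - (u3 - t)) (u3 - t) else 0).

(** Solving the relation for its first term multiplies the generating polynomial by -(1 + X). The
    range extends to b1 = u1 + 1, one step beyond the support, where the formula becomes a condition
    on N. *)
Lemma f_poly b1 b2 b3 : (b1 <= u1.+1)%N -> (b3 <= u3)%N -> (b1 + b2 + b3 = e)%N ->
  f b1 b2 b3 = (-1) ^+ b1 * (('X + 1) ^+ b1 * N)`_(u3 - b3).
Proof.
have f0 a1 a2 a3 : ~ [/\ (a1 <= u1)%N, (a2 <= u2)%N & (a3 <= u3)%N] -> f a1 a2 a3 = 0.
  by move=> h; apply/eqP; apply: contra_notT h; exact: f_supp.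
elim: b1 b2 b3 => [|b1 IH] b2 b3 h1 h3 hs.
  rewrite !expr0 !mul1r coef_poly (_ : (_ < _)%N); last by lia.
  rewrite subKn // (_ : (b3 <= e)%N); last by lia.
  by congr f; lia.
have rel : f b1.+1 b2 b3 + f b1 b2.+1 b3 + f b1 b2 b3.+1 = 0.
  (* Beyond u2 the relation is not among the hypotheses, but all its terms lie outside the
     support. *)
  have [h2|h2] := leqP b2 u2; first by apply: f_rel => //; lia.
  by rewrite !f0 ?addr0 // => -[]; lia.
have -> : f b1.+1 b2 b3 = - (f b1 b2.+1 b3 + f b1 b2 b3.+1).
  by apply/eqP; rewrite -addr_eq0 addrA rel.
rewrite IH //; try lia.
rewrite !exprS mulN1r mulNr -[in RHS]mulrA mulrDl mul1r coefD coefXM mulrDr addrC.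
congr (- (_ + _)); have [h|h] := ltnP b3 u3.
  rewrite IH //; try lia.
  by rewrite (_ : _ == _ = false) ?subnS //; lia.
rewrite (_ : _ == _); last by lia.
by rewrite mulr0 f0 // => -[]; lia.
Qed.

(* For b1 = u1 + 1 the function f vanishes, which by [f_poly] puts a window of
   zeros into the coefficients of (1 + X)^(u1 + 1) N. *)
Lemma weight_run : (exists b1 b2 b3, (b1 + b2 + b3 = e)%N /\ f b1 b2 b3 != 0) ->
  exists c j t, [/\ (u1 + 1 + j = d)%N, (c + t = u3)%N, (t <= j)%N, (c <= e)%N &
    forall m, (m <= c)%N -> (c + d <= m + e)%N -> 'C(d, m)%:R = 0 :> k].
Proof.
move=> [b1 [b2 [b3 [hs nf]]]]; have [h1 h2 h3] := f_supp nf.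
have nN : N != 0.
  apply: contraNneq nf => N0; rewrite f_poly ?N0 //; last by lia.
  by rewrite mulr0 coef0 mulr0.
pose t := (size N).-1.
have sN : size N = t.+1 by rewrite /t prednK // size_poly_gt0.
have tu : (t <= u3)%N.
  have : (size N <= u3.+1)%N by exact: size_poly.
  by rewrite sN.
have := nN; rewrite -lead_coef_eq0 lead_coefE -/t coef_poly ltnS tu.
case: ifP => [ce nft|]; last by rewrite eqxx.
(* The leading coefficient of N is a value of f; its support condition in b2 gives t <= j. *)
have [_ h2' _] := f_supp nft.
exists (u3 - t)%N, (d - u1 - 1)%N, t; split; try lia.
move=> m mc hm.
(* With j = d - u1 - 1, this is the window u3 - (e - d) - j <= m <= u3, written without truncated
   subtraction. *)
have hw := @window_lead k N u1.+1 u3 (u3 + d) (e + (d - u1 - 1)) _ nN.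
have {}hw m' : (m' + t <= u3)%N -> (u3 + d <= m' + (e + (d - u1 - 1)))%N ->
    'C(u1.+1 + t, m')%:R = 0 :> k.
  apply: hw => i hi hi2; have := @f_poly u1.+1 (e - u1.+1 - (u3 - i)) (u3 - i).
  have f0 : f u1.+1 (e - u1.+1 - (u3 - i)) (u3 - i) = 0.
    by apply/eqP; apply: contraT => /f_supp[]; rewrite ltnn.
  rewrite f0 subKn; last by lia.
  move=> h; have /esym/eqP := h ltac:(lia) ltac:(lia) ltac:(lia).
  by rewrite mulf_eq0 signr_eq0 => /eqP.
(* The factor (1 + X)^(j - t) completes the exponent to d and raises the lower end of the window by
   j - t. *)
rewrite -coef_X1n (_ : d = (d - u1 - 1 - t) + (u1.+1 + t))%N; last by lia.
rewrite exprD coefM big1 // => i _; rewrite !coef_X1n.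
have [hi|hi] := leqP i (d - u1 - 1 - t); last by rewrite bin_small // mul0r.
by rewrite hw ?mulr0 //; have := ltn_ord i; lia.
Qed.
End WeightSpaces.

(* L is the coefficient of y_2^(e - c) y_3^c in (-y_2 - y_3)^b1 y_2^b2 y_3^b3. *)
Lemma lambda_rel (k : fieldType) (d e c : nat) (L := fun b1 b3 : nat =>
    if (b3 <= c)%N then (-1) ^+ b1 * 'C(b1, c - b3)%:R else 0 : k) b1 b3 :
  (b3 <= c)%N -> L b1.+1 b3 + L b1 b3 + L b1 b3.+1 = 0.
Proof.
move=> h; rewrite /L h exprS mulN1r; have [h'|h'] := ltnP b3 c.
  have -> : (c - b3 = (c - b3.+1).+1)%N by lia.
  by rewrite binS natrD; ring.
have -> : (c - b3 = 0)%N by lia.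
by rewrite !bin0; ring.
Qed.

(** * Subspaces of finite-dimensional spaces *)

Section Subspaces.
Variable k : fieldType.

(** S is an arbitrary predicate, so classically A is enlarged by a vector of S outside its row space
    as long as there is one; the corank decreases. *)
Lemma subspace_mx n (S : 'rV[k]_n -> Prop) :
  S 0 -> (forall a u v, S u -> S v -> S (a *: u + v)) ->
  exists A : 'M[k]_n, forall v, S v <-> (v <= A)%MS.
Proof.
move=> S0 SL.
suff ext m (A : 'M[k]_n) : (n - \rank A)%N = m -> (forall v, (v <= A)%MS -> S v) ->
    exists A' : 'M[k]_n, forall v, S v <-> (v <= A')%MS.
  by apply: (ext _ 0 (erefl _)) => v; rewrite submx0 => /eqP ->.
elim/ltn_ind: m A => m IH A em hA.
have [h|h] := classic (forall v, S v -> (v <= A)%MS); first by exists A => v; split; auto.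
have [v hv] := not_all_ex_not _ _ h.
have [Sv nvA] := imply_to_and _ _ hv.
have lt : (\rank A < \rank (A + v)%MS)%N.
  by apply: rank_ltmx; rewrite ltmxE addsmxSl addsmx_sub submx_refl; apply/negP.
apply: (IH _ _ (A + v)%MS (erefl _)).
  by have := rank_leq_row (A + v)%MS; lia.
move=> w /sub_addsmxP[[u1 u2] /= ->].
rewrite addrC [u2]mx11_scalar mul_scalar_mx; apply: SL => //.
by apply: hA; exact: submxMl.
Qed.

Variable T : finType.
Variable S : (T -> k) -> Prop.
Hypothesis S0 : S (fun=> 0).
Hypothesis SL : forall a u v, S u -> S v -> S (fun t => a * u t + v t).

Let vec (u : T -> k) : 'rV[k]_#|T| := \row_i u (enum_val i).
Let fct (v : 'rV[k]_#|T|) : T -> k := fun t => v 0 (enum_rank t).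

Lemma vecK u : fct (vec u) = u.
Proof. by apply: functional_extensionality => t; rewrite /fct mxE enum_rankK. Qed.

Lemma subspace_fun : exists A : 'M[k]_#|T|, forall u, S u <-> (vec u <= A)%MS.
Proof.
have fl a v w : fct (a *: v + w) = fun t => a * fct v t + fct w t.
  by apply: functional_extensionality => t; rewrite /fct !mxE.
have f0 : fct 0 = fun=> 0 by apply: functional_extensionality => t; rewrite /fct mxE.
have [||A hA] := @subspace_mx #|T| (fun v => S (fct v)); first by rewrite f0.
  by move=> a u v; rewrite fl; exact: SL.
by exists A => u; rewrite -hA vecK.
Qed.

(** b is a basis of a complement of S. *)
Lemma quotient_basis : exists r (b : 'I_r -> T -> k), forall v,
  exists! c : {ffun 'I_r -> k}, S (fun t => v t - \sum_q c q * b q t).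
Proof.
have [A hA] := subspace_fun.
pose B := row_base (A^C)%MS; exists (\rank (A^C)%MS), (fun q t => B q (enum_rank t)) => v.
have vE (c : {ffun 'I_(\rank (A^C)%MS) -> k}) :
    vec (fun t => v t - \sum_q c q * B q (enum_rank t)) = vec v - (\row_q c q) *m B.
  apply/rowP => i; rewrite !mxE enum_valK; congr (_ - _).
  by apply: eq_bigr => q _; rewrite !mxE.
have /sub_addsmxP[[u1 u2] /= ev] : (vec v <= A + A^C)%MS.
  by apply: submx_full; exact: addsmx_compl_full.
have /submxP[c0 ec0] : (u2 *m (A^C)%MS <= B)%MS by rewrite eq_row_base submxMl.
exists [ffun q => c0 0 q]; split.
  apply/hA; rewrite vE.
  have -> : \row_q [ffun q => c0 0 q] q = c0 by apply/rowP => q; rewrite mxE ffunE.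
  by rewrite -ec0 ev addrK submxMl.
move=> c /hA; rewrite vE => hc.
have h : ((c0 - \row_q c q) *m B <= A :&: A^C)%MS.
  rewrite sub_capmx; apply/andP; split.
    rewrite mulmxBl -ec0 -(addrK (u1 *m A) (u2 *m _)) [u2 *m _ + _]addrC -ev addrAC.
    by apply: addmx_sub => //; rewrite eqmx_opp submxMl.
  by rewrite -(eq_row_base (A^C)%MS) submxMl.
move: h; rewrite capmx_compl submx0 => /eqP h.
have : c0 - \row_q c q = 0 by apply: (row_free_inj (row_base_free _)); rewrite h mul0mx.
move/subr0_eq => e; apply/ffunP => q; rewrite ffunE e mxE //.
Qed.

Lemma separating_functional v : ~ S v ->
  exists mu : T -> k, (forall u, S u -> \sum_t mu t * u t = 0) /\ \sum_t mu t * v t != 0.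
Proof.
have [A hA] := subspace_fun.
move=> nS; have : vec v *m cokermx A != 0.
  by rewrite -submxE; apply/negP => /hA.
case/matrix0Pn => i [j nz]; exists (fun t => cokermx A (enum_rank t) j).
have e u : \sum_t cokermx A (enum_rank t) j * u t = (vec u *m cokermx A) 0 j.
  rewrite mxE (reindex (@enum_rank T)) /=; last by apply: onW_bij; exact: enum_rank_bij.
  by apply: eq_bigr => t _; rewrite [vec u _ _]mxE enum_rankK mulrC.
split=> [u /hA|]; rewrite e; last by rewrite (ord1 i) in nz.
by rewrite submxE => /eqP ->; rewrite mxE.
Qed.
End Subspaces.

(** * Weight spaces *)

Lemma sum3 (V : nmodType) (F : 'I_3 -> V) : \sum_i F i = F 0 + F 1 + F 2.
Proof.
rewrite !big_ord_recl big_ord0 addr0 addrA.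
by congr (F _ + F _ + F _); apply: val_inj.
Qed.

Lemma prod3 (R : comNzRingType) (F : 'I_3 -> R) : \prod_i F i = F 0 * F 1 * F 2.
Proof.
rewrite !big_ord_recl big_ord0 mulr1 mulrA.
by congr (F _ * F _ * F _); apply: val_inj.
Qed.

Definition mnm3 a b c : 'X_{1..3} := [multinom nth 0%N [:: a; b; c] i | i < 3].

Lemma mnm3E a b c : (mnm3 a b c 0 = a) * (mnm3 a b c 1 = b) * (mnm3 a b c 2 = c).
Proof. by rewrite !mnmE. Qed.

Lemma mnm3_eta (m : 'X_{1..3}) : mnm3 (m 0) (m 1) (m 2) = m.
Proof. by apply/mnmP => i; case: (I3_cases i) => ->; rewrite mnm3E. Qed.

Lemma mdeg3 (m : 'X_{1..3}) : mdeg m = (m 0%R + m 1%R + m 2%R)%N.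
Proof. by rewrite mdegE; exact: (sum3 (fun i => m i)). Qed.

Lemma lem3 (m u : 'X_{1..3}) :
  reflect [/\ (m 0%R <= u 0%R)%N, (m 1%R <= u 1%R)%N & (m 2%R <= u 2%R)%N] (m <= u)%MM.
Proof.
apply: (iffP mnm_lepP) => [h|[h0 h1 h2] i]; first by split; exact: h.
by case: (I3_cases i) => ->.
Qed.

Lemma mnm3U a b c :
  [/\ (mnm3 a b c + U_(0%R))%MM = mnm3 a.+1 b c, (mnm3 a b c + U_(1%R))%MM = mnm3 a b.+1 c
    & (mnm3 a b c + U_(2%R))%MM = mnm3 a b c.+1].
Proof.
by split; apply/mnmP => i; case: (I3_cases i) => ->; rewrite mnmDE mnm1E !mnm3E /= ?addn0 ?addn1.
Qed.

Section Grading.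
Variables (k : fieldType) (d e : nat).
Implicit Types (u b : 'X_{1..3}) (c : 'X_{1..3} -> k) (g : 'X_{1..3} -> {mpoly k[3]})
  (z : cochain1 k d).

(* The component of degree u of [delta_exact]: c b is the coefficient of
   x^(u - b) (x) x^b. *)
Definition exactu u c := exists eta : 'X_{1..3} -> k, forall b,
  mdeg b = e -> (b <= u)%MM -> c b = \sum_(i | (0 < b i)%N) eta (b - U_(i))%MM.

Definition compg u g b : k := (g (u - b)%MM)@_b.

Lemma exactuZ u x c : x != 0 -> exactu u (fun b => x * c b) -> exactu u c.
Proof.
move=> x0 [eta h]; exists (fun b => x^-1 * eta b) => b be bu.
by rewrite -mulr_sumr -h // mulKf.
Qed.

Lemma exactu0 u : exactu u (fun=> 0).
Proof. by exists (fun=> 0) => b _ _; rewrite big1. Qed.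

Lemma exactu_comb u x c c' : exactu u c -> exactu u c' -> exactu u (fun b => x * c b + c' b).
Proof.
move=> [eta h] [eta' h']; exists (fun b => x * eta b + eta' b) => b be bu.
by rewrite h // h' // big_split mulr_sumr.
Qed.

Lemma exactu_ext u c c' : (forall b, mdeg b = e -> (b <= u)%MM -> c b = c' b) ->
  exactu u c -> exactu u c'.
Proof. by move=> h [eta he]; exists eta => b be bu; rewrite -h // he. Qed.

Lemma exact_graded g :
  delta_exact d e g <-> forall u, (mdeg u).+1 = (d + e)%N -> exactu u (compg u g).
Proof.
split=> [[H hH] u ud|h].
  exists (fun b => H (u - b)%MM b) => b be bu; rewrite /compg hH //; last first.
    have := congr1 (@mdeg 3) (submK bu); rewrite mdegD; lia.
  apply: eq_bigr => i bi; congr H; apply/mnmP => j; rewrite !(mnmDE, mnmBE) mnm1E.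
  have /mnm_lepP/(_ j) := bu; case: eqP => [<-|_]; lia.
have [et het] : exists et : 'X_{1..3} -> 'X_{1..3} -> k, forall u, (mdeg u).+1 = (d + e)%N ->
    forall b, mdeg b = e -> (b <= u)%MM ->
      compg u g b = \sum_(i | (0 < b i)%N) et u (b - U_(i))%MM.
  refine (@fun_choice 'X_{1..3} ('X_{1..3} -> k) (fun=> 0) (fun u et => (mdeg u).+1 = (d + e)%N ->
    forall b, mdeg b = e -> (b <= u)%MM ->
      compg u g b = \sum_(i | (0 < b i)%N) et (b - U_(i))%MM) _) => u.
  have [ud|ud] := eqVneq (mdeg u).+1 (d + e)%N; last first.
    by exists (fun=> 0) => /eqP; rewrite (negbTE ud).
  by have [et het] := h u ud; exists et.
(* delta preserves the total degree a + b, so the solutions for the various u do not interfere. *)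
exists (fun a b => et (a + b)%MM b) => a b ad be.
have := het (a + b)%MM _ b be (lem_addl _ _); rewrite /compg addmK => ->.
  apply: eq_bigr => i bi; congr (et _ _); rewrite -addmA [(U_(i) + _)%MM]addmC submK //.
  by rewrite lep1mP -lt0n.
by rewrite mdegD -ad be addSn.
Qed.

(** The element of D^(d-1) V (x) Sym^e V concentrated in degree u with coefficients c. *)
Definition gof u c (a : 'X_{1..3}) : {mpoly k[3]} :=
  if (a <= u)%MM then c (u - a)%MM *: 'X_[u - a] else 0.

Lemma homg_gof u c : (mdeg u).+1 = (d + e)%N -> homg d e (gof u c).
Proof.
move=> ud a ad; rewrite /gof; case: ifP => au; last exact: rpred0.
apply: rpredZ; rewrite dhomogX /=; apply/eqP.
have := congr1 (@mdeg 3) (submK au); rewrite mdegD; lia.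
Qed.

Lemma compg_gof u c b : (b <= u)%MM -> compg u (gof u c) b = c b.
Proof.
move=> bu; have e2 : (u - (u - b) = b)%MM.
  apply/mnmP => i; rewrite !mnmBE; have /mnm_lepP/(_ i) := bu; lia.
by rewrite /compg /gof lem_subr e2 mcoeffZ mcoeffX eqxx mulr1.
Qed.

Lemma compg_gof_neq u u' c b : u' != u -> (b <= u')%MM -> compg u' (gof u c) b = 0.
Proof.
move=> nu bu; rewrite /compg /gof; case: ifP => h; last by rewrite mcoeff0.
rewrite mcoeffZ mcoeffX; case: eqP => [e2|]; last by rewrite mulr0.
case/eqP: nu; apply/mnmP => i; have /mnmP/(_ i) := e2; rewrite !mnmBE.
have /mnm_lepP/(_ i) := bu; have /mnm_lepP/(_ i) := h; rewrite !mnmBE; lia.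
Qed.

Lemma exact_gof u c : (mdeg u).+1 = (d + e)%N -> delta_exact d e (gof u c) <-> exactu u c.
Proof.
move=> ud; rewrite exact_graded; split=> [/(_ u ud)|h u' ud'].
  by apply: exactu_ext => b _ bu; exact: compg_gof.
have [->|nu] := eqVneq u' u.
  by apply: exactu_ext h => b _ bu; rewrite compg_gof.
apply: exactu_ext (exactu0 _) => b _ bu.
by rewrite compg_gof_neq.
Qed.

Definition wt u : int * int := ((u 0)%:Z - (u 2)%:Z, (u 1)%:Z - (u 2)%:Z).

(** Equal weights mean a difference in Z (1, 1, 1), which is zero for equal degrees. Thus a weight
    space of H^1 is a single graded piece. *)
Lemma wt_inj u u' : mdeg u = mdeg u' -> wt u = wt u' -> u = u'.
Proof.
rewrite !mdeg3 => h [h1 h2]; rewrite -(mnm3_eta u) -(mnm3_eta u'); congr mnm3; lia.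
Qed.

Lemma monK_char (t : 'I_3 -> k) u : torus t -> monK t u = torus_char (wt u) t.
Proof.
move=> ht; have n0 := torus_neq0 0 ht; have n1 := torus_neq0 1 ht.
have n2 := torus_neq0 2 ht.
rewrite /monK prod3 /torus_char /= !expfzDr // -!exprnN.
have e2 : t 2 = (t 0 * t 1)^-1.
  by apply: (mulfI (mulf_neq0 n0 n1)); rewrite divff ?mulf_neq0 // -prod3.
by rewrite e2 exprVn exprMn invfM -!exprnP; ring.
Qed.

Hypothesis roots : forall n, (0 < n)%N -> exists x : k, x != 0 /\ x ^+ n != 1.

(** The one-parameter subgroups (x, 1, x^-1) and (1, x, x^-1) detect the two coordinates of a
    weight. *)
Lemma char_sep (w w' : int * int) : w != w' ->
  exists t : 'I_3 -> k, torus t /\ torus_char w t != torus_char w' t.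
Proof.
have sep (a b : int) : a != b -> exists x : k, x != 0 /\ x ^ a != x ^ b.
  move=> nab; have [|x [x0 hx]] := @roots (absz (a - b)); first by lia.
  exists x; split=> //; apply: contraNneq hx => h.
  have : x ^ (a - b) = 1 by rewrite expfzDr // h -expfzDr // addrN expr0z.
  have [h0|h0] := boolP (0 <= a - b) => h1.
    by rewrite -h1 exprnP gez0_abs.
  have e1 : (a - b = - (absz (a - b))%:Z) by lia.
  by rewrite -[_ ^+ _]invrK exprnN -e1 h1 invr1.
move=> nw; have [e1|n1] := eqVneq w.1 w'.1.
  have [|x [x0 hx]] := @sep w.2 w'.2.
    by apply: contraNneq nw => e2; rewrite (surjective_pairing w) e1 e2 -surjective_pairing.
  exists (fun i => if i == 1 then x else if i == 2 then x^-1 else 1); split.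
    by rewrite /torus prod3 /= mul1r divff.
  by rewrite /torus_char /= !exp1rz !mul1r.
have [x [x0 hx]] := sep _ _ n1.
exists (fun i => if i == 0 then x else if i == 2 then x^-1 else 1); split.
  by rewrite /torus prod3 /= mulr1 divff.
by rewrite /torus_char /= !exp1rz !mulr1.
Qed.

(** The component of degree u becomes exact after multiplication by the difference of the characters
    [wt u] and w at t, and t is chosen to make this factor invertible. *)
Lemma weight_compg z g w u : homg d e g -> Rep e z g -> weight_cocycle (e%:Z - 1) w z ->
  (mdeg u).+1 = (d + e)%N -> wt u != w -> exactu u (compg u g).
Proof.
move=> hg rz [_ hz] ud nw; have [t [ht ne]] := char_sep nw.
have R2 := Rep_comb (- torus_char w t) rz (Rep_act ht rz).
have hg2 : homg d e (fun a => - torus_char w t *: g a + monK t a *: act_poly t (g a)).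
  move=> a ad; apply: rpredD; first exact/rpredZ/hg.
  apply: rpredZ; rewrite act_polyE big_seq; apply: rpred_sum => m mg; apply: rpredZ.
  by rewrite dhomogX; apply/eqP; move/dhomogP: (hg a ad); apply.
have /(Rep_coboundary hg2 R2)/exact_graded/(_ u ud) : coboundary1 (e%:Z - 1)
    (fun i j l => scalK (- torus_char w t) * z i j l + actDR t (z i j) l).
  have := hz t ht; congr coboundary1.
  apply: functional_extensionality => i; apply: functional_extensionality => j.
  apply: functional_extensionality => l.
  by rewrite {2}/scalK mpolyCN tofracN mulNr addrC.
move=> h; apply: (@exactuZ u (torus_char (wt u) t - torus_char w t)).
  by rewrite subr_eq0.
apply: exactu_ext h => b be bu.
rewrite /compg mcoeffD !mcoeffZ mcoeff_act mulrA -monKD submK // monK_char //.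
by ring.
Qed.

Lemma gof_weight z u c : (mdeg u).+1 = (d + e)%N -> Rep e z (gof u c) ->
  weight_cocycle (d := d) (e%:Z - 1) (wt u) z.
Proof.
move=> ud rz; split=> [|t ht]; first exact: rz.1.
have R2 := Rep_comb (- torus_char (wt u) t) rz (Rep_act ht rz).
have g0 a : - torus_char (wt u) t *: gof u c a + monK t a *: act_poly t (gof u c a) = 0.
  rewrite /gof; case: ifP => au; last by rewrite /act_poly comp_mpoly0 !scaler0 addr0.
  have -> : act_poly t (c (u - a)%MM *: 'X_[u - a])
      = (c (u - a)%MM * monK t (u - a)%MM) *: 'X_[u - a].
    by rewrite /act_poly comp_mpolyZ -/(act_poly _ _) act_polyX scalerA.
  rewrite !scalerA -scalerDl -monK_char // -{1}(submK au) monKD.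
  by rewrite (_ : _ + _ = 0) ?scale0r //; ring.
have hg2 : homg d e (fun a =>
    - torus_char (wt u) t *: gof u c a + monK t a *: act_poly t (gof u c a)).
  by move=> a _; rewrite g0 rpred0.
have /(Rep_coboundary hg2 R2) : delta_exact d e (fun a =>
    - torus_char (wt u) t *: gof u c a + monK t a *: act_poly t (gof u c a)).
  by exists (fun _ _ => 0) => a b _ _; rewrite g0 mcoeff0 big1.
congr coboundary1.
apply: functional_extensionality => i; apply: functional_extensionality => j.
apply: functional_extensionality => l.
by rewrite {1}/scalK mpolyCN tofracN mulNr addrC.
Qed.

Lemma Rep_sum z g (I : Type) (r : seq I) (c : I -> k) (b : I -> cochain1 k d)
    (G : I -> 'X_{1..3} -> {mpoly k[3]}) :
  homg d e g -> (forall q, homg d e (G q)) -> Rep e z g -> (forall q, Rep e (b q) (G q)) ->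
  homg d e (fun a => g a - \sum_(q <- r) c q *: G q a) /\
  Rep e (fun i j l => z i j l - \sum_(q <- r) scalK (c q) * b q i j l)
        (fun a => g a - \sum_(q <- r) c q *: G q a).
Proof.
move=> hg hG rz rb; split=> [a ad|].
  apply: rpredB; first exact: hg.
  by apply: rpred_sum => q _; apply/rpredZ/hG.
elim: r => [|q r IH].
  have -> : (fun a => g a - \sum_(q <- [::]) c q *: G q a) = g.
    by apply: functional_extensionality => a; rewrite big_nil subr0.
  have -> // : (fun i j l => z i j l - \sum_(q <- [::]) scalK (c q) * b q i j l) = z.
  apply: functional_extensionality => i; apply: functional_extensionality => j.
  by apply: functional_extensionality => l; rewrite big_nil subr0.
have := Rep_comb (- c q) (rb q) IH; congr Rep.
  apply: functional_extensionality => i; apply: functional_extensionality => j.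
  apply: functional_extensionality => l; rewrite big_cons.
  by rewrite {1}/scalK mpolyCN tofracN -/(scalK _); ring.
by apply: functional_extensionality => a; rewrite big_cons scaleNr opprD addrCA.
Qed.

Lemma coboundary_weight z g w : homg d e g -> Rep e z g -> weight_cocycle (e%:Z - 1) w z ->
  (forall u, (mdeg u).+1 = (d + e)%N -> wt u = w -> exactu u (compg u g)) ->
  coboundary1 (e%:Z - 1) z.
Proof.
move=> hg rz hz h; apply/(Rep_coboundary hg rz)/exact_graded => u ud.
by have [/h|] := eqVneq (wt u) w; [exact|exact: weight_compg rz hz ud].
Qed.

Lemma weight_dim0 w : (forall u, (mdeg u).+1 = (d + e)%N -> wt u <> w) ->
  weight_dim k d (e%:Z - 1) w 0.
Proof.
move=> nw; exists (fun q : 'I_0 => fun _ _ _ => 0); split=> [[]//|z hz].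
exists [ffun=> 0]; split=> [|c _]; last by apply/ffunP => -[].
have [g hg rz] := Rep_exists hz.1.
have := coboundary_weight hg rz hz (fun u ud uw => False_ind _ (nw u ud uw)).
congr coboundary1.
apply: functional_extensionality => i; apply: functional_extensionality => j.
by apply: functional_extensionality => l; rewrite big_ord0 subr0.
Qed.

Notation Tm := 'X_{1..3 < e.+1}.

(** Passing to the finite type of exponents of degree at most e makes the results on subspaces
    applicable. *)
Definition extm (v : Tm -> k) (b : 'X_{1..3}) : k :=
  if insub b is Some t then v t else 0.

Lemma extmE v (t : Tm) : extm v (val t) = v t.
Proof. by rewrite /extm valK. Qed.

Lemma extm_val c b : mdeg b = e -> extm (fun t => c (val t)) b = c b.
Proof. by move=> be; rewrite /extm insubT ?be //= => h. Qed.

Lemma extm_comb x v v' b : extm (fun t => x * v t + v' t) b = x * extm v b + extm v' b.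
Proof. by rewrite /extm; case: insub => [t|] //; rewrite mulr0 addr0. Qed.

Lemma gof_Rep u : (mdeg u).+1 = (d + e)%N ->
  exists Z : ('X_{1..3} -> k) -> cochain1 k d, forall c, Rep e (Z c) (gof u c).
Proof.
move=> ud; refine (@fun_choice ('X_{1..3} -> k) (cochain1 k d) (fun _ _ _ => 0)
  (fun c z => Rep e z (gof u c)) _) => c.
exact/Rep_surj/homg_gof.
Qed.

Lemma weight_dim_wt u : (mdeg u).+1 = (d + e)%N ->
  exists r, weight_dim k d (e%:Z - 1) (wt u) r.
Proof.
move=> ud; have [Z rZ] := gof_Rep ud.
have ext0 b : extm (fun=> 0) b = 0 by rewrite /extm; case: insub.
have [||r [b hb]] := @quotient_basis k Tm (fun v => exactu u (extm v)).
- by apply: exactu_ext (exactu0 u) => b _ _; rewrite ext0.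
- move=> x v v' h h'; apply: exactu_ext (exactu_comb x h h') => b _ _.
  by rewrite extm_comb.
exists r, (fun q => Z (extm (b q))); split=> [q|z hz]; first exact: gof_weight.
have [g hg rz] := Rep_exists hz.1.
have [c [hc uc]] := hb (fun t => compg u g (val t)).
(* In the other degrees the component of z is exact by its weight, and the chosen cocycles have
   none; only degree u decides. *)
have key (c' : {ffun 'I_r -> k}) :
    coboundary1 (e%:Z - 1) (fun i j l => z i j l - \sum_(q < r) scalK (c' q) * Z (extm (b q)) i j l)
    <-> exactu u (extm (fun t => compg u g (val t) - \sum_q c' q * b q t)).
  have [hg' rz'] := Rep_sum (index_enum 'I_r) c' hg (fun q => homg_gof (extm (b q)) ud) rz
    (fun q => rZ (extm (b q))).
  have e1 u' b' : compg u' (fun a => g a - \sum_q c' q *: gof u (extm (b q)) a) b'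
      = compg u' g b' - \sum_q c' q * compg u' (gof u (extm (b q))) b'.
    rewrite /compg mcoeffB raddf_sum; congr (_ - _).
    by apply: eq_bigr => q _; rewrite /= mcoeffZ.
  rewrite (Rep_coboundary hg' rz') exact_graded.
  have e2 b' : mdeg b' = e -> (b' <= u)%MM ->
      compg u (fun a => g a - \sum_q c' q *: gof u (extm (b q)) a) b'
      = extm (fun t => compg u g (val t) - \sum_q c' q * b q t) b'.
    move=> be bu; rewrite e1 /extm insubT ?be // => h; congr (_ - _).
    by apply: eq_bigr => q _; rewrite compg_gof // /extm insubT ?be.
  split=> [/(_ u ud)|h u' ud']; first exact: exactu_ext.
  have [->|nu] := eqVneq u' u.
    by apply: exactu_ext h => b' be bu; rewrite e2.
  have nw : wt u' != wt u.
    by apply: contraNneq nu => /wt_inj->//; apply: succn_inj; rewrite ud ud'.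
  apply: exactu_ext (weight_compg hg rz hz ud' nw) => b' be bu.
  rewrite e1 big1 ?subr0 // => q _.
  by rewrite compg_gof_neq ?mulr0.
exists c; split; first exact/key.
by move=> c' /key/uc.
Qed.

Lemma coboundary0 : coboundary1 (d := d) (e%:Z - 1) (fun (_ _ : 'I_3) _ => 0 : conefun k).
Proof.
exists (fun _ _ => 0); split=> [i|i j l]; last by rewrite subr0.
split; first exact: sym_multilinear0.
by move=> l _; apply: OO0; exact: set1n0.
Qed.

Lemma weight_dim_neq0 w r : weight_dim k d (e%:Z - 1) w r ->
  r != 0%N <-> exists u c, [/\ (mdeg u).+1 = (d + e)%N, wt u = w & ~ exactu u c].
Proof.
move=> [b [wb hb]]; split=> [r0|[u [c [ud uw nc]]]].
  case: (classic (exists u c, [/\ (mdeg u).+1 = (d + e)%N, wt u = w & ~ exactu u c])) => // nx.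
  have allex u c : (mdeg u).+1 = (d + e)%N -> wt u = w -> exactu u c.
    by move=> ud uw; apply: NNPP => nc; apply: nx; exists u, c.
  have r0' : (0 < r)%N by rewrite lt0n.
  pose q0 := Ordinal r0'.
  have [g hg rz] := Rep_exists (wb q0).1.
  have cb := coboundary_weight hg rz (wb q0) (fun u ud uw => allex u _ ud uw).
  have [c0 [_ uc]] := hb _ (wb q0).
  (* If everything were exact, the zero vector and the q0-th unit vector would both represent b q0,
     against uniqueness. *)
  have e1 := uc [ffun=> 0] _; have e2 := uc [ffun q => (q == q0)%:R] _.
  have : [ffun=> 0] = [ffun q => (q == q0)%:R] :> {ffun 'I_r -> k}.
    rewrite -e1 ?e2 //.
      have := coboundary0; congr coboundary1.
      apply: functional_extensionality => i; apply: functional_extensionality => j.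
      apply: functional_extensionality => l.
      rewrite (bigD1 q0) //= ffunE eqxx big1 ?addr0; last first.
        by move=> q /negbTE nq; rewrite ffunE nq scalK0 mul0r.
      by rewrite scalK1 mul1r subrr.
    move: cb; congr coboundary1.
    apply: functional_extensionality => i; apply: functional_extensionality => j.
    apply: functional_extensionality => l.
    by rewrite big1 ?subr0 // => q _; rewrite ffunE scalK0 mul0r.
  by move/ffunP/(_ q0)/eqP; rewrite !ffunE eqxx eq_sym oner_eq0.
apply/negP => /eqP r0; subst r; have [Z rZ] := gof_Rep ud.
have wz : weight_cocycle (e%:Z - 1) w (Z c) by rewrite -uw; exact: gof_weight.
have [c0 [hc0 _]] := hb _ wz.
have : coboundary1 (e%:Z - 1) (Z c).
  move: hc0; congr coboundary1.
  apply: functional_extensionality => i; apply: functional_extensionality => j.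
  by apply: functional_extensionality => l; rewrite big_ord0 subr0.
by move/(Rep_coboundary (homg_gof c ud) (rZ c))/(exact_gof _ ud).
Qed.
End Grading.

(** * Weights occurring in H^1 *)

Section Occurrence.
Variables (k : fieldType) (d e : nat).
Implicit Types (u b : 'X_{1..3}) (c : 'X_{1..3} -> k).
Notation Tm := 'X_{1..3 < e.+1}.

(** This transposes delta: t = b + U_(i) is the only exponent lowered to b by U_(i). *)
Lemma sum_shift (F : 'X_{1..3} -> k) b i : (mdeg b).+1 = e ->
  \sum_(t : Tm) F (val t) * ((0 < val t i)%N && (val t - U_(i) == b)%MM)%:R = F (b + U_(i))%MM.
Proof.
move=> be; have hb : (mdeg (b + U_(i))%MM < e.+1)%N by rewrite mdegU be.
rewrite (bigD1 (BMultinom hb)) //= addmK eqxx mnmDE mnm1E eqxx addn1 /= mulr1.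
rewrite big1 ?addr0 // => t nt.
case: (boolP (_ && _)) => [/andP[ti /eqP et]|]; last by rewrite mulr0.
case/eqP: nt; apply: val_inj => /=; rewrite -et submK //.
by rewrite lep1mP -lt0n.
Qed.

Lemma not_exactu_run u c : (mdeg u).+1 = (d + e)%N -> ~ exactu e u c ->
  exists a j t, [/\ (u 0%R + 1 + j = d)%N, (a + t = u 2%R)%N, (t <= j)%N, (a <= e)%N &
    forall m, (m <= a)%N -> (a + d <= m + e)%N -> 'C(d, m)%:R = 0 :> k].
Proof.
move=> ud nc.
have ext0 b : extm (k := k) (e := e) (fun=> 0) b = 0 by rewrite /extm; case: insub.
pose S (v : Tm -> k) := exactu e u (extm v).
have S0 : S (fun=> 0) by rewrite /S; apply: exactu_ext (exactu0 k e u) => b _ _; rewrite ext0.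
have SL x v v' : S v -> S v' -> S (fun t => x * v t + v' t).
  rewrite /S => h h'; apply: exactu_ext (exactu_comb x h h') => b _ _.
  by rewrite extm_comb.
have nS : ~ S (fun t => c (val t)).
  by rewrite /S => h; apply: nc; apply: exactu_ext h => b be _; rewrite extm_val.
have [mu [muS muv]] := separating_functional S0 SL nS.
(* [exactu] imposes nothing on other exponents, so their indicators are exact and mu kills them. *)
have mu0 (t : Tm) : ~ (mdeg (val t) = e /\ (val t <= u)%MM) -> mu t = 0.
  move=> nt; have := muS (fun t' => (t' == t)%:R) _.
  rewrite (bigD1 t) //= eqxx mulr1 big1 ?addr0; last by move=> t' /negbTE ->; rewrite mulr0.
  apply; apply: exactu_ext (exactu0 k e u) => b be bu; rewrite /extm.
  case: insubP => [t' _ et'|] //; case: eqP => // ett; case: nt.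
  by rewrite -ett et'.
have muE b : extm mu b != 0 -> mdeg b = e /\ (b <= u)%MM.
  rewrite /extm; case: insubP => [t _ et|]; last by rewrite eqxx.
  move=> nz; apply: NNPP => h; move: nz; rewrite mu0 ?eqxx // et.
  exact: h.
pose f (b1 b2 b3 : nat) := extm mu (mnm3 b1 b2 b3).
apply: (@weight_run k d e (u 0) (u 1) (u 2) f).
- by move: ud; rewrite mdeg3; lia.
- by move=> b1 b2 b3 /muE[_ /lem3]; rewrite !mnm3E.
- move=> b1 b2 b3 h1 h2 h3 hs.
  have bu : (mnm3 b1 b2 b3 <= u)%MM by apply/lem3; rewrite !mnm3E.
  have be : (mdeg (mnm3 b1 b2 b3)).+1 = e by rewrite mdeg3 !mnm3E; lia.
  (* The relation at b states that mu kills the image under delta of the indicator of b. *)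
  have e0 : \sum_t mu t * (\sum_(i | (0 < val t i)%N) ((val t - U_(i))%MM == mnm3 b1 b2 b3)%:R) = 0.
    apply: muS; exists (fun b => (b == mnm3 b1 b2 b3)%:R) => b be' bu'.
    by rewrite /extm insubT ?be'.
  rewrite /f; have [<- <- <-] := mnm3U b1 b2 b3.
  rewrite -(sum3 (fun i => extm mu (mnm3 b1 b2 b3 + U_(i))%MM)) -[RHS]e0.
  under eq_bigr => i _ do rewrite -(sum_shift _ _ be).
  rewrite exchange_big /=; apply: eq_bigr => t _; rewrite mulr_sumr [RHS]big_mkcond /=.
  by apply: eq_bigr => i _; rewrite extmE; case: ifP; rewrite ?mulr0.
have [t nt] : exists t, mu t != 0.
  apply: NNPP => h; case/eqP: muv; apply: big1 => t _.
  by have [->|nt] := eqVneq (mu t) 0; [rewrite mul0r | case: h; exists t].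
have := @muE (val t); rewrite extmE => /(_ nt)[te _].
exists (val t 0), (val t 1), (val t 2); rewrite /f mnm3_eta extmE -mdeg3.
by split.
Qed.

(** The functional M below is the one with N = 1; it kills all exact elements and takes the value 1
    on the indicator of [top]. *)
Lemma run_not_exactu a : (0 < d)%N -> (a <= e)%N ->
  (forall m, (m <= a)%N -> (a + d <= m + e)%N -> 'C(d, m)%:R = 0 :> k) ->
  exists c, ~ exactu e (mnm3 d.-1 (e - a) a) c.
Proof.
move=> d0 ae hz; set u := mnm3 _ _ _; pose top := mnm3 0 (e - a) a.
have tope : mdeg top = e by rewrite mdeg3 !mnm3E; lia.
have topu : (top <= u)%MM by apply/lem3; rewrite !mnm3E.
exists (fun b => (b == top)%:R) => -[eta he].
pose L (b1 b3 : nat) : k := if (b3 <= a)%N then (-1) ^+ b1 * 'C(b1, a - b3)%:R else 0.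
pose M (b : 'X_{1..3}) : k := if (b <= u)%MM && (mdeg b == e) then L (b 0%R) (b 2%R) else 0.
have Mrel b : (b <= u)%MM -> (mdeg b).+1 = e -> \sum_i M (b + U_(i))%MM = 0.
  move=> bu be; rewrite sum3 -(mnm3_eta b); move/lem3: bu.
  move: be; rewrite mdeg3; move: (b 0) (b 1) (b 2) => b1 b2 b3 be; rewrite !mnm3E => -[h1 h2 h3].
  have [-> -> ->] := mnm3U b1 b2 b3.
  (* M agrees with L even when a coordinate is raised out of u: for b1 by the zeros of row d, for b2
     because the binomial vanishes for reasons of degree, for b3 by the guard in L. *)
  have L1 : M (mnm3 b1.+1 b2 b3) = L b1.+1 b3.
    rewrite /M !mnm3E mdeg3 !mnm3E (_ : _ == e) ?andbT; last by lia.
    case: lem3 => // nu; have e1 : b1.+1 = d.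
      have [h|h] := leqP b1.+1 d.-1; last by lia.
      by case: nu; rewrite !mnm3E.
    by rewrite /L h3 e1 hz ?mulr0 //; lia.
  have L2 : M (mnm3 b1 b2.+1 b3) = L b1 b3.
    rewrite /M !mnm3E mdeg3 !mnm3E (_ : _ == e) ?andbT; last by lia.
    case: lem3 => // nu; have e1 : (b2 = e - a)%N.
      have [h|h] := leqP b2.+1 (e - a)%N; last by lia.
      by case: nu; rewrite !mnm3E.
    by rewrite /L h3 bin_small ?mulr0 //; lia.
  have L3 : M (mnm3 b1 b2 b3.+1) = L b1 b3.+1.
    rewrite /M !mnm3E mdeg3 !mnm3E (_ : _ == e) ?andbT; last by lia.
    case: lem3 => // nu; have e1 : b3 = a.
      have [h|h] := leqP b3.+1 a; last by lia.
      by case: nu; rewrite !mnm3E.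
    by rewrite /L e1 ltnn.
  by rewrite L1 L2 L3; exact: lambda_rel.
have M1 : \sum_(t : Tm) M (val t) * (val t == top)%:R = 1.
  have ht : (mdeg top < e.+1)%N by rewrite tope.
  rewrite (bigD1 (BMultinom ht)) //= eqxx mulr1 big1 ?addr0 => [|t nt]; last first.
    case: eqP => [et|_]; last by rewrite mulr0.
    by case/eqP: nt; apply: val_inj.
  by rewrite /M topu tope eqxx /L !mnm3E leqnn subnn bin0 expr0 mulr1.
have : \sum_(t : Tm) M (val t) * (val t == top)%:R = 0; last first.
  by rewrite M1 => /eqP; rewrite oner_eq0.
transitivity (\sum_(t : Tm) \sum_i \sum_(s : 'X_{1..3 < e} | ((mdeg s).+1 == e) && (s <= u)%MM)
   M (val t) * ((0 < val t i)%N && (val t - U_(i) == s)%MM)%:R * eta s).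
  apply: eq_bigr => t _; have [M0|] := eqVneq (M (val t)) 0.
    by rewrite M0 mul0r big1 // => i _; rewrite big1 // => s _; rewrite !mul0r.
  rewrite {1}/M; case: ifP => [/andP[tu /eqP te] _|]; last by rewrite eqxx.
  rewrite he // mulr_sumr big_mkcond /=; apply: eq_bigr => i _.
  case: (boolP (0 < _)%N) => ti; last by rewrite big1 // => s _; rewrite mulr0 mul0r.
  have ds : (mdeg (val t - U_(i))%MM < e)%N by rewrite mdegBU // te.
  rewrite (bigD1 (BMultinom ds)) /=; last first.
    rewrite mdegBU // te eqxx /=; exact: lepm_trans (lem_subr _ _) tu.
  rewrite eqxx mulr1 big1 ?addr0 // => s /andP[_ ns].
  case: eqP => [es|_]; last by rewrite mulr0 mul0r.
  by case/eqP: ns; apply: val_inj.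
under eq_bigr do rewrite exchange_big.
rewrite exchange_big big1 //= => s /andP[/eqP se su].
rewrite exchange_big /= -[RHS](mul0r (eta s)) -[X in _ = X * _](Mrel s su se) mulr_suml.
by apply: eq_bigr => i _; rewrite -mulr_suml sum_shift.
Qed.

Hypothesis roots : forall n, (0 < n)%N -> exists x : k, x != 0 /\ x ^+ n != 1.

(** This justifies the [epsilon] in [h1]: every weight space has a dimension, which is zero outside
    the finite list [ws]. *)
Lemma h1_spec w : exists r, weight_dim k d (e%:Z - 1) w r /\ coeff w (h1 k d e) = r%:Z.
Proof.
rewrite /h1; set P := (X in epsilon _ X); suff hP : exists h, P h.
  by exact: (epsilon_spec (inhabits 0) P hP w).
pose ws := undup [seq wt (val u) | u : 'X_{1..3 < d + e}].
have [R hR] : exists R : int * int -> nat, forall v, weight_dim k d (e%:Z - 1) v (R v) /\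
    (v \notin ws -> R v = 0%N).
  refine (@fun_choice (int * int) nat 0%N (fun v r => weight_dim k d (e%:Z - 1) v r /\
    (v \notin ws -> r = 0%N)) _) => v.
  have [[u [ud <-]]|nu] := classic (exists u, (mdeg u).+1 = (d + e)%N /\ wt u = v).
    have [r hr] := weight_dim_wt roots ud; exists r; split=> // /negP; case.
    have ud' : (mdeg u < d + e)%N by rewrite ud.
    by rewrite mem_undup; apply/imageP; exists (BMultinom ud').
  exists 0%N; split=> //; apply: weight_dim0 => // u ud uv; apply: nu; by exists u.
exists (\sum_(v <- ws) << (R v)%:Z *g v >>) => v; exists (R v); split; first exact: (hR v).1.
rewrite raddf_sum /=; under eq_bigr do rewrite coeffU.
have [vw|vw] := boolP (v \in ws).
  rewrite (bigD1_seq v) ?undup_uniq //= eqxx mulr1 big1 ?addr0 // => v' /negbTE ->.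
  by rewrite mulr0.
rewrite (hR v).2 // big_seq big1 // => v' hv'; case: eqP => [ev|_]; last by rewrite mulr0.
by move: vw; rewrite -ev hv'.
Qed.

Lemma occurs_h1 w : occurs w (h1 k d e) <->
  exists u c, [/\ (mdeg u).+1 = (d + e)%N, wt u = w & ~ exactu e u c].
Proof.
have [r [hr ew]] := h1_spec w.
by rewrite -(weight_dim_neq0 roots hr) /occurs ew eqz_nat.
Qed.
End Occurrence.

(** * The highest weight *)

Lemma closed_roots (k : closedFieldType) n : (0 < n)%N -> exists x : k, x != 0 /\ x ^+ n != 1.
Proof.
(* P takes the value 1 at 0 and wherever x^n = 1, so any root of P will do. *)
move=> n0; pose P := 'X * ('X^n - 1) + 1 : {poly k}.
have sP : size P != 1%N.
  have s1 : size ('X^n - 1 : {poly k}) = n.+1 by rewrite -polyC1 size_XnsubC.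
  have nz : ('X^n - 1 : {poly k}) != 0 by rewrite -size_poly_gt0 s1.
  rewrite /P size_polyDl ?size_poly1 mulrC size_mulX // s1 //.
have [x /rootP] := closed_rootP P sP; rewrite !hornerE => hx.
exists x; split; apply/negP => /eqP e; move/eqP: hx.
  by rewrite e mul0r add0r oner_eq0.
by rewrite e subrr mulr0 add0r oner_eq0.
Qed.

Lemma weight_comb (a b : int) : omega1 *~ a + omega2 *~ b = (a + b, b).
Proof.
have h (w : int * int) (n : int) : w *~ n = (w.1 * n, w.2 * n).
  by rewrite [LHS]surjective_pairing (raddfMz fst) (raddfMz snd) !mulrzz.
by rewrite !h /omega1 /omega2 /= !mul1r mul0r; congr pair; rewrite add0r.
Qed.

Theorem theorem1p8 (p : nat) (k : closedFieldType) (d e : nat) :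
  prime p -> p \in [pchar k] -> h1 k d e != 0 ->
  ((e < d)%N ->
     highest_weight (h1 k d e) (omega1 *~ (d%:Z - 1 - e%:Z) + omega2 *~ e%:Z) /\
     omega1 *~ (d%:Z - 1 - e%:Z) + omega2 *~ e%:Z = (d%:Z - 1, e%:Z)) /\
  ((d <= e)%N ->
     (exists s m d' e' : nat, expansion p d e s m d' e') /\
     (forall s m d' e' : nat,
        expansion p d e s m d' e' ->
        (forall s1 m1 d1 e1 : nat,
           expansion p d e s1 m1 d1 e1 -> (p ^ s <= p ^ s1)%N) ->
        highest_weight (h1 k d e)
          (omega1 *~ d'%:Z + omega2 *~ (e%:Z - 2 * e'%:Z - 2)) /\
        omega1 *~ d'%:Z + omega2 *~ (e%:Z - 2 * e'%:Z - 2)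
          = (d%:Z - e'%:Z - 2, e%:Z - 2 * e'%:Z - 2))).
Proof.
move=> pp charp nz; have p1 := prime_gt1 pp; have p0 := prime_gt0 pp.
have occP := fun w => @occurs_h1 k d e (@closed_roots k) w.
have occ w : occurs w (h1 k d e) -> exists u, exists2 a, (mdeg u).+1 = (d + e)%N /\ wt u = w &
  exists j t, [/\ (u 0%R + 1 + j = d)%N, (a + t = u 2%R)%N, (t <= j)%N, (a <= e)%N &
    forall m, (m <= a)%N -> (a + d <= m + e)%N -> 'C(d, m)%:R = 0 :> k].
  move=> /occP[u [c [ud uw nc]]]; have [a [j [t h]]] := not_exactu_run ud nc.
  by exists u, a => //; exists j, t.
have occ_run a : (0 < d)%N -> (a <= e)%N ->
    (forall m, (m <= a)%N -> (a + d <= m + e)%N -> 'C(d, m)%:R = 0 :> k) ->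
    occurs (d%:Z - 1 - a%:Z, e%:Z - a%:Z - a%:Z) (h1 k d e).
  move=> d0 ae hz; have [c nc] := run_not_exactu d0 ae hz.
  apply/occP; exists (mnm3 d.-1 (e - a) a), c; split=> //.
    by rewrite mdeg3 !mnm3E; lia.
  by rewrite /wt !mnm3E; congr pair; lia.
split=> hde.
  rewrite weight_comb; have -> : d%:Z - 1 - e%:Z + e%:Z = d%:Z - 1 by ring.
  split=> //; split.
    (* For e < d the window is empty, so c = 0 satisfies the condition vacuously. *)
    have := @occ_run 0%N; rewrite !subr0; apply; [lia|lia|].
    by move=> m; lia.
  move=> w /occ[u [a [ud <-] [j [t [h1' h2 h3 h4 _]]]]]; rewrite /lex_le /=.
  by move: ud; rewrite mdeg3; lia.
have run_exp a : (a <= e)%N ->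
    (forall m, (m <= a)%N -> (a + d <= m + e)%N -> 'C(d, m)%:R = 0 :> k) ->
    exists r, expansion p d e r (d %/ p ^ r) (d %% p ^ r) (d %% p ^ r + (e - d)) /\
      (d %% p ^ r + (e - d) + 1 <= a)%N.
  move=> ae hz.
  (* A run of zeros avoids both ends of the row, where the binomials are 1. *)
  have g_lt : (e - d < a)%N.
    rewrite ltnNge; apply/negP => h; have := hz 0%N (leq0n _); rewrite bin0.
    by move=> /(_ ltac:(lia))/eqP; rewrite oner_eq0.
  have a_lt : (a < d)%N.
    rewrite ltnNge; apply/negP => h; have := hz d h; rewrite binn.
    by move=> /(_ ltac:(lia))/eqP; rewrite oner_eq0.
  have [|r [r1 r2 r3 r4]] := @zero_run k p charp a d (e - d) _ g_lt a_lt.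
    by move=> m m1 m2; apply: hz => //; lia.
  exists r; split=> //; split; first exact: divn_eq.
  split; last by split=> //; split=> //; split; lia.
  by have := divn_eq d (p ^ r); lia.
split.
  have [w hw] : exists w, occurs w (h1 k d e).
    apply: NNPP => h; case/eqP: nz; apply/eqP/freeg_eqP => w; rewrite coeff0.
    by apply/eqP; apply: contra_notT h => hw; exists w.
  have [u [a _ [j [t [_ _ _ h4 h5]]]]] := occ w hw.
  have [r [hr _]] := run_exp a h4 h5.
  by exists r, (d %/ p ^ r)%N, (d %% p ^ r)%N, (d %% p ^ r + (e - d))%N.
move=> s m d' e' [ed [ee [m0 [pm [d2 e2]]]]] smin.
have q0 : (0 < p ^ s)%N by rewrite expn_gt0 p0.
have mq : (0 < m * p ^ s)%N by rewrite muln_gt0 m0.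
have dm : d' = (d %% p ^ s)%N by rewrite ed modnMDl modn_small //; lia.
have e1 : e' = (d' + (e - d))%N by lia.
(* The claimed weight belongs to the run ending at c = e' + 1. *)
have eqw : (d%:Z - e'%:Z - 2, e%:Z - 2 * e'%:Z - 2)
    = (d%:Z - 1 - (e'.+1)%:Z, e%:Z - (e'.+1)%:Z - (e'.+1)%:Z) by congr pair; lia.
rewrite weight_comb; have -> : d'%:Z + (e%:Z - 2 * e'%:Z - 2) = d%:Z - e'%:Z - 2 by lia.
split=> //; split.
  rewrite eqw; apply: occ_run; [lia|lia|].
  (* The run consists of d' + 1, ..., e' + 1, inside the first gap d' < i < p^s. *)
  move=> i i1 i2; have iq : (i < p ^ s)%N by lia.
  have := @lucas k p charp s m d' 0 i ltac:(lia) iq; rewrite mul0n add0n -ed => ->.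
  by rewrite [X in _ * X%:R]bin_small ?mulr0 //; lia.
move=> w /occ[u [a [ud <-] [j [t [h1' h2 h3 h4 h5]]]]]; rewrite /lex_le /=.
have [r [hr ra]] := run_exp a h4 h5.
have sr : (s <= r)%N by have := smin _ _ _ _ hr; rewrite leq_exp2l.
(* As s <= r, d' is the remainder of d mod p^r modulo p^s; together with [ra] this gives e' + 1 <=
   a. *)
have d'r : (d' <= d %% p ^ r)%N.
  rewrite dm -(modn_dvdm d (dvdn_exp2l p sr)); exact: leq_mod.
by move: ud; rewrite mdeg3; lia.
Qed.
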